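(* Let $m\ge2$ and let $k$ be an integer with $(k-7)(m-1)\ge20$. Then $UC_3(c_1=k-3)$, $UC_3(c_1=k-4,c_2=1)$ and $U_3C(c_1=k-4)$ are, in this order, the connected unicyclic $m$-uniform hypergraphs with $k$ edges in $\mathcal{P}(\mathcal{H})$ having the first three largest spectral radii; that is, $\lambda_1(UC_3(c_1=k-3))>\lambda_1(UC_3(c_1=k-4,c_2=1))>\lambda_1(U_3C(c_1=k-4))$, and every other connected unicyclic $m$-uniform hypergraph with $k$ edges in $\mathcal{P}(\mathcal{H})$ has spectral radius strictly smaller than $\lambda_1(U_3C(c_1=k-4))$.
   Context: A hypergraph has a finite vertex set and an edge set of non-empty subsets of the vertex set; it is $m$-uniform if all edges have cardinality $m$, and linear if two distinct edges share at most one vertex. The adjacency matrix of a linear $m$-uniform hypergraph has $(i,j)$ entry $\frac{1}{m-1}$ if $i\ne j$ lie in a common edge, and $0$ otherwise; $\lambda_1$ denotes the spectral radius of this matrix. The $m$-th power hypergraph of a graph $G(V,E)$ is the $m$-uniform hypergraph obtained by adding to each edge $e\in E$ $m-2$ new vertices $v_{e,1},\dots,v_{e,m-2}$ (distinct for distinct edges). $\mathcal{P}(\mathcal{H})$ denotes the set of $m$-th power hypergraphs of graphs. A loose cycle of length $l\ge3$, $C_L(l)=v_1e_1v_2e_2\dots v_le_lv_1$, is the $m$-uniform hypergraph with edges $e_1,\dots,e_l$ in which $e_{i-1}\cap e_i=\{v_i\}$ (indices mod $l$, the $v_i$ distinct) and non-consecutive edges are disjoint; $v_1,\dots,v_l$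 are its core vertices. A linear hypergraph is unicyclic if it contains exactly one loose cycle. Attaching an edge at a vertex $v$ means adding a new edge consisting of $v$ and $m-1$ new vertices. $UC_l(c_1,\dots,c_l)$ is obtained from $C_L(l)$ by attaching $c_i$ (pendant) edges at $v_i$ for $i=1,\dots,l$; when only some of the $c_i$ are listed, the others are $0$. $U_3C(c_1=k-4)$ is the hypergraph with $k$ edges obtained from $UC_3(c_1=k-4)$ by attaching one more edge at a degree-one vertex of one of the $k-4$ pendant edges at $v_1$. *)

(* Defs.v *)
From mathcomp Require Import all_boot all_order all_algebra.
From mathcomp Require Import reals complex.
Set Implicit Arguments.
Unset Strict Implicit.
Unset Printing Implicit Defensive.
Import Order.TTheory GRing.Theory Num.Theory.

Record hypergraph := Hypergraph {
  hvert :> finType;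
  hedges : {set {set hvert}};
  hedges_nonempty : set0 \notin hedges }.

Definition huniform (m : nat) (H : hypergraph) : Prop :=
  forall e : {set H}, e \in hedges H -> #|e| = m.

Definition hlinear (H : hypergraph) : Prop :=
  forall e f : {set H},
    e \in hedges H -> f \in hedges H -> e != f -> #|e :&: f| <= 1.

Definition hadj (H : hypergraph) : rel H :=
  [rel x y | (x != y) && [exists e in hedges H, (x \in e) && (y \in e)]].

Definition hconnected (H : hypergraph) : Prop :=
  forall x y : H, connect (@hadj H) x y.

Definition hiso (H1 H2 : hypergraph) : Prop :=
  exists2 f : H1 -> H2, bijective f &
    hedges H2 = [set f @: (e : {set H1}) | e in hedges H1].

(* The edge set of a loose cycle v_0 e_0 v_1 e_1 ... v_(l-1) e_(l-1) v_0, with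
   indices modulo l (ordS is the cyclic successor). The e_i are automatically
   distinct. A loose cycle is a subhypergraph, so it is identified with its set
   of edges: rotations and reversals of the sequence are the same cycle. *)
Definition is_loose_cycle (V : finType) (C : {set {set V}}) : Prop :=
  exists (l : nat) (v : 'I_l -> V) (e : 'I_l -> {set V}),
    [/\ 3 <= l,
        injective v,
        forall i : 'I_l, e i :&: e (ordS i) = [set v (ordS i)],
        forall i j : 'I_l, j != i -> j != ordS i -> i != ordS j ->
          [disjoint e i & e j]
      & C = [set e i | i : 'I_l]].

Definition unicyclic (H : hypergraph) : Prop :=
  hlinear H /\
  exists! C : {set {set H}}, C \subset hedges H /\ is_loose_cycle C.

Section Power.
Variables (m : nat) (G : hypergraph).

Let gedge : finType := {e : {set G} | e \in hedges G}.
Let pvert : finType := (G + gedge * 'I_(m - 2))%type.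

Definition power_edge (e : gedge) : {set pvert} :=
  [set inl x | x in val e] :|: [set inr (e, j) | j : 'I_(m - 2)].

Lemma power_edges_nonempty : set0 \notin [set power_edge e | e : gedge].
Proof.
apply/negP => /imsetP[e _ /setP E].
have [x0|[x xe]] := set_0Vmem (val e).
  by move: (hedges_nonempty G); rewrite -x0 (valP e).
by have := E (inl x); rewrite !inE imset_f.
Qed.

Definition power_hypergraph : hypergraph := Hypergraph power_edges_nonempty.

End Power.

(* A simple graph is a 2-uniform hypergraph. *)
Definition is_power (m : nat) (H : hypergraph) : Prop :=
  exists2 G : hypergraph, huniform 2 G & hiso (power_hypergraph m G) H.

Section LooseCycle.
Variables (m l : nat).

Let cvert : finType := ('I_l + 'I_l * 'I_(m - 2))%type.

Definition cycle_edge (i : 'I_l) : {set cvert} :=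
  [set inl i; inl (ordS i)] :|: [set inr (i, j) | j : 'I_(m - 2)].

Lemma cycle_edges_nonempty : set0 \notin [set cycle_edge i | i : 'I_l].
Proof.
apply/negP => /imsetP[i _ /setP E].
by have := E (inl i); rewrite !inE eqxx.
Qed.

(* For l >= 3 and m >= 2 this is C_L(l); its core vertices are the inl i. *)
Definition loose_cycle : hypergraph := Hypergraph cycle_edges_nonempty.

End LooseCycle.

(* Attach c x new edges at each vertex x of H. The new edges are indexed by the
   pairs p = (x, i) with i < c x, and inr (p, j), j < m - 1, are the new
   vertices of the edge p. *)
Section Attach.
Variables (m : nat) (H : hypergraph) (c : H -> nat).

Let pend : finType := {x : H & 'I_(c x)}.
Let avert : finType := (H + pend * 'I_(m - 1))%type.

Definition old_edge (e : {set H}) : {set avert} := [set inl x | x in e].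

Definition new_edge (p : pend) : {set avert} :=
  inl (tag p) |: [set inr (p, j) | j : 'I_(m - 1)].

Lemma attach_edges_nonempty :
  set0 \notin [set old_edge e | e in hedges H] :|: [set new_edge p | p : pend].
Proof.
apply/negP; rewrite inE => /orP[] /imsetP[e].
  move=> eH /setP E; have [e0|[x xe]] := set_0Vmem e.
    by move: (hedges_nonempty H); rewrite -e0 eH.
  by have := E (inl x); rewrite inE imset_f.
by move=> _ /setP E; have := E (inl (tag e)); rewrite !inE eqxx.
Qed.

Definition attach : hypergraph := Hypergraph attach_edges_nonempty.

End Attach.

(* UC m l [:: c_1; ...; c_r]: missing entries of the list count as 0. *)
Definition UC (m l : nat) (c : seq nat) : hypergraph :=
  attach m (H := loose_cycle m l)
    (fun x => if x is inl i then nth 0 c i else 0).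

(* U_3C(c_1 = a): the further edge is attached at the 0-th new vertex of the
   0-th pendant edge; all choices are equivalent under automorphisms. It is
   attached only if a >= 1 and m >= 2. *)
Definition U3C (m a : nat) : hypergraph :=
  attach m (H := UC m 3 [:: a])
    (fun x => if x is inr (p, j)
              then ((tagged p == 0 :> nat) && (j == 0 :> nat) : nat)
              else 0).

Definition adjmx (R : realType) (m : nat) (H : hypergraph) : 'M[R]_#|H| :=
  \matrix_(i, j) (if hadj (enum_val i) (enum_val j)
                  then ((m - 1)%:R : R)^-1 else 0)%R.

Definition spectral_radius (R : realType) (n : nat) (A : 'M[R]_n) : R :=
  sup (fun r : R => exists2 z : R[i],
         eigenvalue (map_mx (real_complex R) A) z
       & r = ComplexField.Normc.normc z).

Definition lambda1 (R : realType) (m : nat) (H : hypergraph) : R :=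
  spectral_radius (adjmx R m H).

Definition unicyclic_power (m k : nat) (H : hypergraph) : Prop :=
  [/\ hconnected H, unicyclic H, huniform m H, #|hedges H| = k & is_power m H].

(* Main.v *)
(* Write the hypergraph as the m-th power of a connected unicyclic graph G and
   let tau = (m - 1) lambda_1, sg = tau - m + 2, th = (m - 2) / (tau + 1). In an
   eigenvector the value at a new vertex is determined by the two graph vertices
   of its edge; eliminating these values leaves on G the quadratic form
   sum over the edges xy of 2 x y + th (x^2 + y^2), with eigenvalue sg + th.

   Two graphs on the same vertices are compared by evaluating both forms at the
   Perron vector of one of them, which settles the graphs having a vertex
   adjacent to all others but at most one: UC_3(k-3), UC_3(k-4,1), U_3C(k-4)
   and the quadrangle with k-4 pendant edges at one vertex.

   Any other G has, with respect to the vertex v where its Perron vector is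
   maximal, two vertices not adjacent to v. Its form is then, after completing
   squares along a spanning tree rooted at v, too small for lambda_1(G) to reach
   the spectral radius of the star with k-2 edges, which U_3C(k-4) exceeds. The
   hypothesis (k - 7)(m - 1) >= 20 says exactly that sg >= 5 for that star. *)

(* The form and its eigenvalue both depend on lambda_1 through [th] and [sg], so a plain Rayleigh
   quotient cannot compare two graphs. The way out is to freeze tau: if at some test vector the form
   with parameters taken at tau exceeds [sg + th] times the squared norm, then tau lies strictly
   below (m - 1) lambda_1. All strict comparisons rest on this.

   The estimate for graphs with two vertices not adjacent to v is a budget in units of
   [bt = th + 1 / sg]. With the Perron vector normalised to 1 at v, the eigenvalue identity splits
   over the k - 1 tree edges into nonnegative terms whose sum is at most [bt] plus the share of the
   edge ab. The bound is [bt] and not 0 because the reference star has one edge fewer than the tree.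
   A vertex not adjacent to v contributes about [bt]: one is affordable, two are not, provided the
   losses caused by ab and by nonzero values at the parents stay below [bt], which [sg >= 5]
   ensures. This is why graphs with at most one such vertex need explicit comparisons. *)
Require Import Defs.
From mathcomp Require Import classical_sets reals complex spectral sesquilinear.
From mathcomp Require Import all_boot all_order all_algebra ring lra.
Set Implicit Arguments.
Unset Strict Implicit.
Unset Printing Implicit Defensive.
Import Order.TTheory GRing.Theory Num.Theory.
Local Open Scope ring_scope.

(** * Spectral radius of a symmetric nonnegative matrix *)

Section SymmetricSpectrum.
Local Open Scope sesquilinear_scope.
Variables (R : realType) (n : nat) (A : 'M[R]_n).
Hypothesis A_sym : A^T = A.
Let AC := map_mx (real_complex R) A.
Let P := spectralmx AC.
Let D := spectral_diag AC.
Let rho := spectral_radius A.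

Let conj_real (x : R) : (real_complex R x)^* = real_complex R x.
Proof. by apply/CrealP; apply/complex_realP; exists x. Qed.

Let AC_herm : AC \is hermsymmx.
Proof.
apply: realsym_hermsym.
  apply/is_hermitianmxP; rewrite expr0 scale1r map_mx_id//.
  by rewrite /AC map_trmx A_sym.
by apply/mxOverP => i j; rewrite mxE; apply/complex_realP; exists (A i j).
Qed.

Let AC_diag : AC = P^t* *m diag_mx D *m P.
Proof.
rewrite -invmx_unitary ?spectral_unitarymx//.
exact/orthomx_spectralP/hermitian_normalmx/AC_herm.
Qed.

Let PPt : P *m P^t* = 1%:M.
Proof. exact/unitarymxP/spectral_unitarymx. Qed.

Let PtP : P^t* *m P = 1%:M.
Proof. by rewrite -invmx_unitary ?spectral_unitarymx// mulVmx ?spectral_unit. Qed.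

Let row_eigen i : row i P *m AC = D 0 i *: row i P.
Proof.
rewrite -row_mul AC_diag !mulmxA PPt mul1mx mul_diag_mx.
by apply/rowP => j; rewrite !mxE.
Qed.

Let row_neq0 i : row i P != 0.
Proof.
apply/eqP => r0; have : row i (P *m P^t*) = 0 by rewrite row_mul r0 mul0mx.
by rewrite PPt => /rowP/(_ i)/eqP; rewrite !mxE eqxx oner_eq0.
Qed.

Let D_eigen i : eigenvalue AC (D 0 i).
Proof. by apply/eigenvalueP; exists (row i P). Qed.

Let eigen_D z : eigenvalue AC z -> exists i, z = D 0 i.
Proof.
case/eigenvalueP => v vA v0; pose w := v *m P^t*.
have wD : w *m diag_mx D = z *: w.
  rewrite /w -mulmxA -[diag_mx D]mulmx1 -PPt !mulmxA -(mulmxA v) -(mulmxA v).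
  by rewrite -AC_diag vA scalemxAl.
have w0 : w != 0.
  apply: contra v0 => /eqP w0; apply/eqP.
  by rewrite -[v]mulmx1 -PtP mulmxA -/w w0 mul0mx.
have /rV0Pn [i wi] := w0; exists i; move/rowP/(_ i): wD.
rewrite mul_mx_diag [LHS]mxE [RHS]mxE mulrC => wDz.
by apply: (mulIf wi); rewrite wDz.
Qed.

Let normcE (z : R[i]) : `|z| = (ComplexField.Normc.normc z)%:C%C.
Proof. by []. Qed.

Let specset : set R := fun r => exists2 z, eigenvalue AC z & r = ComplexField.Normc.normc z.

Let normc_ge0 (z : R[i]) : 0 <= ComplexField.Normc.normc z.
Proof. by case: z => a b; apply: sqrtr_ge0. Qed.

Let specset_ub : has_ubound specset.
Proof.
exists (\sum_i ComplexField.Normc.normc (D 0 i)) => r [z /eigen_D[i ->] ->].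
by rewrite (bigD1 i)//= lerDl sumr_ge0.
Qed.

Let D_le i : ComplexField.Normc.normc (D 0 i) <= rho.
Proof. by apply: (ub_le_sup specset_ub); exists (D 0 i). Qed.

Let rho_attained : (0 < n)%N -> exists i, rho = ComplexField.Normc.normc (D 0 i).
Proof.
move=> n0; pose i0 := Ordinal n0.
case: (@arg_maxP _ _ _ i0 xpredT (fun i => ComplexField.Normc.normc (D 0 i))) => // i _ imax.
exists i; apply/eqP; rewrite eq_le D_le andbT.
apply: ge_sup; first by exists (ComplexField.Normc.normc (D 0 i)), (D 0 i).
by move=> r [z /eigen_D[j ->] ->]; apply: imax.
Qed.

(** In the coordinates of the unitary diagonalisation both sides are weighted sums of [|y_i|^2], and
    each real weight [D_i] is at most its modulus, hence at most [rho]. *)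
Lemma rayleigh_le (x : 'rV[R]_n) :
  (x *m A *m x^T) 0 0 <= rho * (x *m x^T) 0 0.
Proof.
pose xC := map_mx (real_complex R) x; pose y := xC *m P^t*.
have xC_conj : xC^t* = map_mx (real_complex R) x^T.
  by apply/matrixP => i j; rewrite !mxE conj_real.
have e1 : ((x *m A *m x^T) 0 0)%:C%C = \sum_i D 0 i * `|y 0 i| ^+ 2.
  have -> : ((x *m A *m x^T) 0 0)%:C%C = (xC *m AC *m xC^t*) 0 0.
    by rewrite xC_conj -!map_mxM [RHS]mxE.
  have -> : xC *m AC *m xC^t* = y *m diag_mx D *m y^t*.
    by rewrite AC_diag /y trmx_mul map_mxM trmxCK !mulmxA.
  rewrite mxE; apply: eq_bigr => i _.
  by rewrite mul_mx_diag !mxE normCK mulrAC mulrC mulrA.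
have e2 : ((x *m x^T) 0 0)%:C%C = \sum_i `|y 0 i| ^+ 2.
  have -> : ((x *m x^T) 0 0)%:C%C = (xC *m xC^t*) 0 0.
    by rewrite xC_conj -!map_mxM [RHS]mxE.
  have -> : xC *m xC^t* = y *m y^t*.
    by rewrite /y trmx_mul map_mxM trmxCK mulmxA -(mulmxA xC) PtP mulmx1.
  by rewrite mxE; apply: eq_bigr => i _; rewrite !mxE normCK.
rewrite -lecR rmorphM/= e1 e2 mulr_sumr; apply: ler_sum => i _.
apply: ler_wpM2r; first by rewrite exprn_ge0.
have Dr : D 0 i \is Num.real by apply/mxOverP/hermitian_spectral_diag_real/AC_herm.
apply: le_trans (real_ler_norm Dr) _.
by rewrite normcE lecR D_le.
Qed.

Hypothesis A_ge0 : forall i j, 0 <= A i j.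

Let perron_sub : (0 < n)%N -> exists w : 'rV[R]_n,
  [/\ forall i, 0 <= w 0 i, w != 0 & forall i, rho * w 0 i <= (w *m A) 0 i].
Proof.
move=> n0; have [i rhoE] := rho_attained n0; pose u := row i P.
exists (\row_j ComplexField.Normc.normc (u 0 j)); split.
- by move=> j; rewrite mxE.
- have /rV0Pn[j uj] := row_neq0 i; apply/rV0Pn; exists j; rewrite mxE.
  by apply: contra uj => /eqP/ComplexField.Normc.eq0_normc ->.
move=> k; rewrite mxE -lecR rmorphM /= rhoE -!normcE -normrM.
have -> : D 0 i * u 0 k = (u *m AC) 0 k by rewrite row_eigen [RHS]mxE.
rewrite !mxE; apply: le_trans (ler_norm_sum _ _ _) _.
rewrite (rmorph_sum (real_complex R)); apply: ler_sum => j _.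
rewrite !mxE normrM rmorphM /= normcE; apply: ler_wpM2l; first by rewrite -normcE.
by rewrite ger0_norm// ler0c.
Qed.

(* The moduli of an eigenvector for the eigenvalue of largest modulus satisfy
   w A >= rho w; a strict inequality in one coordinate would allow increasing
   the Rayleigh quotient beyond rho by moving w in that direction. *)
Lemma perron_vector : (0 < n)%N -> exists w : 'rV[R]_n,
  [/\ forall i, 0 <= w 0 i, w != 0 & w *m A = rho *: w].
Proof.
case/perron_sub => w [w0 wN0 wA]; exists w; split=> //.
pose B := A - rho%:M; pose g := w *m B.
have B_sym : B^T = B by rewrite /B linearB /= A_sym tr_scalar_mx.
have q_le0 (x : 'rV[R]_n) : (x *m B *m x^T) 0 0 <= 0.
  rewrite /B mulmxBr mulmxBl mul_mx_scalar -scalemxAl mxE [X in _ + X]mxE.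
  by rewrite [X in _ - X]mxE subr_le0 rayleigh_le.
have gE : g = w *m A - rho *: w by rewrite /g /B mulmxBr mul_mx_scalar.
have g0 i : 0 <= g 0 i.
  by rewrite gE [leRHS]mxE [X in _ + X]mxE [X in _ - X]mxE subr_ge0.
suff gk0 k : g 0 k = 0.
  apply/eqP; rewrite -subr_eq0 -gE; apply/eqP/rowP => k.
  by rewrite gk0 mxE.
apply/eqP; rewrite eq_le g0 andbT leNgt; apply/negP => gk_gt0.
pose d : 'rV[R]_n := delta_mx 0 k.
have gd : (g *m d^T) 0 0 = g 0 k by rewrite /d trmx_delta -colE mxE.
have dg : (d *m B *m w^T) 0 0 = g 0 k.
  have -> : d *m B *m w^T = (g *m d^T)^T.
    by rewrite trmx_mul trmxK /g trmx_mul B_sym mulmxA.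
  by rewrite mxE.
have gw : 0 <= (g *m w^T) 0 0.
  by rewrite mxE; apply: sumr_ge0 => i _; apply: mulr_ge0 => //; rewrite mxE.
clearbody B; set c := (d *m B *m d^T) 0 0.
have qe e : 2 * e * g 0 k + e ^+ 2 * c <= 0.
  apply: (le_trans _ (q_le0 (w + e *: d))).
  rewrite [(_ + _)^T]linearD /= [(_ *: d)^T]linearZ /= !mulmxDl !mulmxDr -!scalemxAl -!scalemxAr.
  have addE (M1 M2 M3 M4 : 'M[R]_1) : (M1 + e *: M2 + (e *: M3 + e *: (e *: M4))) 0 0 =
      M1 0 0 + e * M2 0 0 + (e * M3 0 0 + e * (e * M4 0 0)) by rewrite !mxE.
  rewrite -/g addE gd dg -/c.
  by rewrite -subr_ge0; apply: le_trans gw _; rewrite le_eqVlt; apply/orP; left; apply/eqP; ring.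
(* Dividing by [|c| + 1] makes the linear term dominate whatever the sign of [c]. *)
have := qe (g 0 k / (`|c| + 1)); apply/negP; rewrite -ltNge.
set G := g 0 k in gk_gt0 *; have c1 : 0 < `|c| + 1 by rewrite ltr_wpDl.
have -> : 2 * (G / (`|c| + 1)) * G + (G / (`|c| + 1)) ^+ 2 * c =
  G ^+ 2 / (`|c| + 1) ^+ 2 * (2 * (`|c| + 1) + c) by field; rewrite gt_eqF.
rewrite mulr_gt0 ?divr_gt0 ?exprn_gt0//.
have := ler_norm (- c); rewrite normrN => ?.
by have := normr_ge0 c; lra.
Qed.

End SymmetricSpectrum.

(** * The spectral radius of a hypergraph and its invariance under isomorphism *)

Lemma hadj_sym (H : hypergraph) : symmetric (@hadj H).
Proof.
move=> x y; rewrite /hadj /= eq_sym; congr (_ && _).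
by apply: eq_existsb => e; rewrite (andbC (x \in e)).
Qed.

Section Lambda1.
Variables (R : realType) (m : nat) (H : hypergraph).
Hypothesis m_gt1 : (1 < m)%N.

Let mR := (m - 1)%:R : R.

Let mR_gt0 : 0 < mR.
Proof. by rewrite ltr0n subn_gt0. Qed.

Let A := adjmx R m H.

Let A_sym : A^T = A.
Proof. by apply/matrixP => i j; rewrite !mxE hadj_sym. Qed.

Let sumE (F : H -> R) : \sum_u F u = \sum_(i < #|H|) F (enum_val i).
Proof. by rewrite -big_enum_val. Qed.

Let A_row (x : H -> R) j :
  ((\row_i x (enum_val i)) *m A) 0 j =
  mR^-1 * \sum_(v | hadj (enum_val j) v) x v.
Proof.
rewrite mxE [in RHS]big_mkcond mulr_sumr sumE.
apply: eq_bigr => i _; rewrite !mxE hadj_sym mulrC.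
by case: ifP => _; rewrite ?mul0r ?mulr0.
Qed.

Lemma lambda1_rayleigh (x : H -> R) :
  \sum_u \sum_(v | hadj u v) x u * x v <=
  (m - 1)%:R * lambda1 R m H * \sum_u x u ^+ 2.
Proof.
have := rayleigh_le A_sym (\row_i x (enum_val i)).
rewrite -(ler_pM2l mR_gt0) mulrA => le_x; apply: le_trans (le_trans _ le_x) _.
  rewrite mxE mulr_sumr sumE.
  apply: ler_sum => i _; rewrite A_row !mxE !mulrA mulfV ?gt_eqF// mul1r.
  by rewrite mulrC mulr_sumr.
rewrite mxE sumE.
by rewrite le_eqVlt; apply/orP; left; apply/eqP; congr (_ * _); apply: eq_bigr => i _; rewrite !mxE.
Qed.

Lemma lambda1_perron : (0 < #|H|)%N -> exists x : H -> R,
  [/\ forall u, 0 <= x u, exists u, x u != 0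
    & forall u, \sum_(v | hadj u v) x v = (m - 1)%:R * lambda1 R m H * x u].
Proof.
have A_ge0 i j : 0 <= A i j by rewrite mxE; case: ifP => // _; rewrite invr_ge0 ltW.
move=> /(perron_vector A_sym A_ge0) [w [w0 /rV0Pn[i wi] wA]].
exists (fun u => w 0 (enum_rank u)); split=> [u||u] //.
  by exists (enum_val i); rewrite enum_valK.
move/rowP/(_ (enum_rank u)): wA.
have wE : w = \row_i w 0 (enum_rank (enum_val i)).
  by apply/rowP => j; rewrite mxE enum_valK.
rewrite {1}wE (A_row (fun u => w 0 (enum_rank u))) enum_rankK mxE => /(congr1 ( *%R mR)).
by rewrite /= mulVKf ?gt_eqF// => ->; rewrite mulrA.
Qed.

End Lambda1.

Lemma hiso_sym (H1 H2 : hypergraph) : hiso H1 H2 -> hiso H2 H1.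
Proof.
case=> f [g fK gK] HE; exists g; first by exists f.
rewrite HE; apply/setP => e; apply/idP/imsetP => [eH|[_ /imsetP[e' e'H ->] ->]].
  exists (f @: e); first exact: imset_f.
  by rewrite -imset_comp (eq_imset _ (fK : g \o f =1 id)) imset_id.
by rewrite -imset_comp (eq_imset _ (fK : g \o f =1 id)) imset_id.
Qed.

Lemma hiso_trans (H2 H1 H3 : hypergraph) : hiso H1 H2 -> hiso H2 H3 -> hiso H1 H3.
Proof.
case=> f f_bij fE [g g_bij gE]; exists (g \o f); first exact: bij_comp.
by rewrite gE fE -imset_comp; apply: eq_imset => e /=; rewrite -imset_comp.
Qed.

Lemma hadj_iso (H1 H2 : hypergraph) (f : H1 -> H2) x y : injective f ->
  hedges H2 = [set f @: (e : {set H1}) | e in hedges H1] ->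
  hadj (f x) (f y) = hadj x y.
Proof.
move=> f_inj HE; rewrite /hadj /= (inj_eq f_inj) HE; congr (_ && _).
apply/existsP/existsP => -[e /andP[eH exy]].
  by case/imsetP: eH exy => e' e'H ->; rewrite !mem_imset// => exy; exists e'; rewrite e'H.
by exists (f @: e); apply/andP; split; [exact: imset_f | rewrite !mem_imset].
Qed.

(** The Perron vector of [H1], carried over by the bijection, is a test vector for [H2] with the
    same Rayleigh quotient. *)
Lemma lambda1_hiso_le (R : realType) (m : nat) (H1 H2 : hypergraph) :
  (1 < m)%N -> (0 < #|H1|)%N -> hiso H1 H2 -> lambda1 R m H1 <= lambda1 R m H2.
Proof.
move=> m_gt1 H1_gt0 [f f_bij HE]; have [g fK gK] := f_bij.
have [x [x0 [u0 xu0] xE]] := lambda1_perron R m_gt1 H1_gt0.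
have := lambda1_rayleigh m_gt1 (x \o g).
have -> : \sum_u (x \o g) u ^+ 2 = \sum_u x u ^+ 2.
  by rewrite (reindex f) /=; [apply: eq_bigr => u _; rewrite fK|exact: onW_bij].
have -> : \sum_u \sum_(v | hadj u v) (x \o g) u * (x \o g) v =
    (m - 1)%:R * lambda1 R m H1 * \sum_u x u ^+ 2.
  rewrite (reindex f) /=; last exact: onW_bij.
  rewrite mulr_sumr; apply: eq_bigr => u _; rewrite (reindex f) /=; last exact: onW_bij.
  rewrite expr2 mulrA -xE mulr_suml; apply: eq_big => [v|v _].
    exact: hadj_iso (bij_inj f_bij) HE.
  by rewrite !fK mulrC.
set S := \sum_(i : H1) _.
have S_gt0 : 0 < S.
  apply: (@lt_le_trans _ _ (x u0 ^+ 2)); first by rewrite exprn_even_gt0.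
  by rewrite /S (bigD1 u0)//= lerDl sumr_ge0// => i _; rewrite sqr_ge0.
by rewrite ler_pM2r// ler_pM2l// ltr0n subn_gt0.
Qed.

Lemma lambda1_hiso (R : realType) (m : nat) (H1 H2 : hypergraph) :
  (1 < m)%N -> (0 < #|H1|)%N -> hiso H1 H2 -> lambda1 R m H1 = lambda1 R m H2.
Proof.
move=> m_gt1 H1_gt0 H12; apply/eqP; rewrite eq_le lambda1_hiso_le//=.
apply: lambda1_hiso_le => //; last exact: hiso_sym.
by case: H12 => f /bij_eq_card <-.
Qed.

(** * Eigenvectors of power hypergraphs *)

Section LinearHypergraph.
Variables (R : realType) (H : hypergraph).
Hypothesis H_lin : hlinear H.

(** By linearity a neighbour of [u] shares exactly one edge with [u], so summing edge by edge counts
    nothing twice. *)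
Lemma hadj_sum (F : H -> R) u :
  \sum_(v | hadj u v) F v =
  \sum_(e in hedges H | u \in e) (\sum_(v in e) F v - F u).
Proof.
under [RHS]eq_bigr => e /andP[_ ue] do rewrite (bigD1 u)//= [_ - _]addrC addKr.
rewrite (exchange_big_dep (fun v => hadj u v))/= => [|e v /andP[eH ue] /andP[ve vu]].
  apply: eq_bigr => v /andP[uv /existsP[e /and3P[eH ue ve]]].
  rewrite (big_pred1 e)// => e' /=; apply/idP/eqP => [|->]; last first.
    by rewrite eH ue ve eq_sym uv.
  case/andP=> /andP[e'H ue'] /andP[ve' _]; apply/eqP/contraT => e'e.
  have := H_lin e'H eH e'e; rewrite leqNgt (cardsD1 u) (cardsD1 v) !inE.
  by rewrite ue' ve' ue ve eq_sym uv.
by rewrite /hadj /= eq_sym vu; apply/existsP; exists e; rewrite eH ue ve.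
Qed.

Lemma hadj_quadratic (x : H -> R) :
  \sum_u \sum_(v | hadj u v) x u * x v =
  \sum_(e in hedges H) ((\sum_(v in e) x v) ^+ 2 - \sum_(v in e) x v ^+ 2).
Proof.
under eq_bigr do rewrite -mulr_sumr hadj_sum mulr_sumr.
rewrite (exchange_big_dep (mem (hedges H)))/= => [|u e _ /andP[]//].
apply: eq_bigr => e eH; rewrite eH/= expr2 mulr_suml -sumrB.
by apply: eq_bigr => u _; rewrite mulrBr expr2.
Qed.

End LinearHypergraph.

Section PowerEdges.
Variables (m : nat) (G : hypergraph).
Hypothesis G_unif : huniform 2 G.
Local Notation P := (power_hypergraph m G).

(** Indexed by a bare set, unlike [power_edge], so that no proof of membership in [hedges G] has to
    be carried along. *)
Definition pedge (A : {set G}) : {set P} :=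
  [set z | match z with inl x => x \in A | inr q => val q.1 == A end].

Lemma power_edgeE (e : {e : {set G} | e \in hedges G}) : power_edge m e = pedge (val e).
Proof.
apply/setP => -[x|[e' j]]; rewrite !inE /=.
  rewrite mem_imset; last by move=> ? ? [].
  by rewrite orbC; case: imsetP => // -[].
apply/orP/eqP => [[/imsetP[]//|/imsetP[j' _ [-> _]]//]|/val_inj ->].
by right; apply: imset_f.
Qed.

Lemma hedges_power : hedges P = [set pedge A | A in hedges G].
Proof.
apply/setP => z; apply/imsetP/imsetP => [[e _ ->]|[A AG ->]].
  by exists (val e); [exact: valP|exact: power_edgeE].
by exists (exist _ A AG); rewrite // power_edgeE.
Qed.

Lemma pedge_inj : injective pedge.
Proof.
by move=> A B /setP AB; apply/setP => x; have := AB (inl x); rewrite !inE.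
Qed.

Lemma pedgeI A B : A != B -> pedge A :&: pedge B = [set inl x | x in A :&: B].
Proof.
move=> AB; apply/setP => -[x|q]; rewrite !inE /=.
  by rewrite mem_imset ?inE; last by move=> ? ? [].
case: imsetP => [[]//|_]; apply/negbTE; apply: contra AB.
by case/andP => /eqP -> /eqP ->.
Qed.

Lemma graph_edgeI A B : A \in hedges G -> B \in hedges G -> A != B -> (#|A :&: B| <= 1)%N.
Proof.
move=> AG BG AB; rewrite leqNgt; apply: contra AB => I2.
have /eqP <- : A :&: B == A by rewrite eqEcard subsetIl (G_unif AG).
by rewrite eqEcard subsetIr (G_unif BG).
Qed.

Lemma power_linear : hlinear P.
Proof.
move=> e f; rewrite hedges_power => /imsetP[A AG ->] /imsetP[B BG ->].
rewrite (inj_eq pedge_inj) => AB; rewrite pedgeI// card_imset ?graph_edgeI//.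
by move=> ? ? [].
Qed.

Lemma big_pedge (T : Type) (idx : T) (op : Monoid.com_law idx) (F : P -> T) A (AG : A \in hedges G) :
  \big[op/idx]_(z in pedge A) F z =
  op (\big[op/idx]_(x in A) F (inl x)) (\big[op/idx]_(j < m - 2) F (inr (exist _ A AG, j))).
Proof.
rewrite big_sumType /=; congr (op _ _); first by apply: eq_bigl => x; rewrite inE.
rewrite (reindex_onto (fun j => (exist _ A AG, j)) snd) /=.
  by apply: eq_bigl => j; rewrite inE /= !eqxx.
by case=> [[B BG] j]; rewrite inE /= => /eqP BA; congr (_, _); apply: val_inj.
Qed.

Lemma power_uniform : (1 < m)%N -> huniform m P.
Proof.
move=> m_gt1 e; rewrite hedges_power => /imsetP[A AG ->].
rewrite -sum1_card (big_pedge _ _ AG) /= !sum_nat_const card_ord (G_unif AG) !muln1.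
by rewrite addnC subnK.
Qed.

End PowerEdges.

(* For a pair e = xy this is 2 x y + th (x^2 + y^2). *)
Definition qform (R : realFieldType) (T : finType) (th : R) (x : T -> R) (e : {set T}) : R :=
  (\sum_(u in e) x u) ^+ 2 - (1 - th) * \sum_(u in e) x u ^+ 2.

Section PowerTransfer.
Variables (R : realType) (m : nat) (G : hypergraph).
Hypotheses (m_gt1 : (1 < m)%N) (G_unif : huniform 2 G).
Local Notation P := (power_hypergraph m G).
Local Notation mR := (m%:R : R).

Let m2E : (m - 2)%:R = mR - 2.
Proof. by rewrite natrB. Qed.

Let m2_ge0 : 0 <= mR - 2.
Proof. by rewrite -m2E ler0n. Qed.

(** The value [S / (sg + 1)] of the test vector at the new vertices of an edge with sum [S] solves
    [tau y = S + (m - 3) y], the eigenvalue equation there. Since [th] and [sg] are computed from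
    the given [tau], any real number can be tested against the spectral radius. *)
Lemma power_lower (x : G -> R) (tau : R) (sg := tau - mR + 2) (th := (mR - 2) / (tau + 1)) :
  0 < sg -> (sg + th) * (\sum_u x u ^+ 2) < \sum_(e in hedges G) qform th x e ->
  tau < (m - 1)%:R * lambda1 R m P.
Proof.
move=> sg0 lt_q; pose S (A : {set G}) := \sum_(u in A) x u.
have t0 : 0 < tau + 1 by move: m2_ge0; rewrite /sg in sg0; lra.
have s0 : sg + 1 != 0 by rewrite gt_eqF//; lra.
have t0' : tau + 1 != 0 by rewrite gt_eqF.
pose X (z : P) := match z with inl u => x u | inr q => S (val q.1) / (sg + 1) end.
have := lambda1_rayleigh m_gt1 X; rewrite hadj_quadratic; last exact: power_linear.
rewrite hedges_power big_imset /=; last by move=> A B _ _; exact: pedge_inj.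
have SP A : A \in hedges G -> \sum_(z in pedge m A) X z = S A * ((tau + 1) / (sg + 1)).
  move=> AG; rewrite (big_pedge _ _ AG) /= sumr_const card_ord -mulr_natr m2E -/(S A).
  by rewrite /sg in s0 *; field.
have S2P A : A \in hedges G -> \sum_(z in pedge m A) X z ^+ 2 =
    \sum_(u in A) x u ^+ 2 + (mR - 2) * (S A / (sg + 1)) ^+ 2.
  move=> AG; rewrite (big_pedge _ _ AG) /=; congr (_ + _).
  by rewrite sumr_const card_ord -[LHS]mulr_natr m2E mulrC.
have X2 : \sum_z X z ^+ 2 =
    \sum_u x u ^+ 2 + \sum_(A in hedges G) (mR - 2) * (S A / (sg + 1)) ^+ 2.
  rewrite big_sumType /=; congr (_ + _); rewrite [RHS]big_sub.
  rewrite -(pair_bigA _ (fun A j => (S (val A) / (sg + 1)) ^+ 2)) /=; apply: eq_bigr => A _.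
  by rewrite sumr_const card_ord -[LHS]mulr_natr m2E mulrC.
have X2_ge0 : 0 <= \sum_z X z ^+ 2 by apply: sumr_ge0 => z _; exact: sqr_ge0.
move=> le_X; rewrite ltNge; apply/negP => le_t.
have {le_X} : \sum_(A in hedges G) ((\sum_(v in pedge m A) X v) ^+ 2 - \sum_(v in pedge m A) X v ^+ 2)
   <= tau * \sum_z X z ^+ 2 by apply: le_trans le_X _; apply: ler_wpM2r.
apply/negP; rewrite -ltNge X2 mulrDr -ltrBrDr [X in _ - X]mulr_sumr -sumrB.
(* With the [tau]-terms of the new vertices moved to the edge sum, every edge contributes the same
   multiple of its form, because [(1 - th) (tau + 1) = sg + 1]. *)
rewrite (eq_bigr (fun A => (tau + 1) / (sg + 1) * qform th x A)); last first.
  move=> A AG; rewrite SP// S2P// /qform -/(S A).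
  set s2 := \sum_(u in A) _; rewrite /th /sg in s0 *; field.
  by rewrite t0' s0.
have c0 : 0 < (tau + 1) / (sg + 1) by rewrite divr_gt0//; lra.
rewrite -mulr_sumr -(ltr_pdivrMl _ _ c0).
apply: le_lt_trans lt_q; rewrite le_eqVlt; apply/orP; left; apply/eqP.
by rewrite /th /sg in s0 *; field; rewrite t0' s0.
Qed.

(* The summand for an edge uw is x_w + th x_u. *)
Definition graph_eigen (th sg : R) (x : G -> R) : Prop := forall u,
  (sg + th) * x u = \sum_(e in hedges G | u \in e) (\sum_(v in e) x v - (1 - th) * x u).

Lemma graph_eigen_qform th sg x : graph_eigen th sg x ->
  (sg + th) * (\sum_u x u ^+ 2) = \sum_(e in hedges G) qform th x e.
Proof.
move=> xE; rewrite mulr_sumr.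
under eq_bigr do rewrite expr2 mulrA xE mulr_suml.
rewrite (exchange_big_dep (mem (hedges G)))/= => [|u e _ /andP[]//].
apply: eq_bigr => e eH; rewrite eH/= /qform expr2 mulr_sumr mulr_sumr -sumrB.
by apply: eq_bigr => u _; ring.
Qed.

(** The equation at a new vertex makes its value the edge sum divided by [tau + 1]. Substituting
    this at the graph vertices and rescaling by [(sg + 1) / (tau + 1)] leaves the reduced system. *)
Lemma power_perron (tau := (m - 1)%:R * lambda1 R m P)
    (sg := tau - mR + 2) (th := (mR - 2) / (tau + 1)) :
  (0 < #|G|)%N -> 0 < sg -> exists x : G -> R,
  [/\ forall u, 0 <= x u, exists u, x u != 0 & graph_eigen th sg x].
Proof.
move=> G0 sg0.
have P0 : (0 < #|P|)%N by rewrite card_sum addn_gt0 G0.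
have [X [X0 [z Xz] XE]] := lambda1_perron R m_gt1 P0.
have t0 : 0 < tau + 1 by move: m2_ge0; rewrite /sg in sg0; lra.
have s0 : sg + 1 != 0 by rewrite gt_eqF//; lra.
have t0' : tau + 1 != 0 by rewrite gt_eqF.
pose S (A : {set G}) := \sum_(u in A) X (inl u); pose SP (A : {set G}) := \sum_(z in pedge m A) X z.
have Xr q : X (inr q) = SP (val q.1) / (tau + 1).
  have := XE (inr q); rewrite (hadj_sum (power_linear G_unif)) (big_pred1 (pedge m (val q.1))); last first.
    move=> e; rewrite hedges_power; apply/andP/eqP => [[/imsetP[A AG ->]]|->].
      by rewrite inE => /eqP ->.
    by rewrite imset_f ?inE ?eqxx//; exact: valP.
  rewrite -/(SP _) -/tau => e; apply: (mulIf t0').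
  by rewrite mulfVK// mulrDr mulr1 mulrC -e; ring.
have SPE A : A \in hedges G -> SP A = S A * ((tau + 1) / (sg + 1)).
  move=> AG; have : SP A = S A + (mR - 2) * (SP A / (tau + 1)).
    rewrite {1}/SP (big_pedge _ _ AG) /= -/(S A); congr (_ + _).
    under eq_bigr do rewrite Xr /=.
    by rewrite sumr_const card_ord -[LHS]mulr_natr m2E mulrC.
  move=> e; rewrite /sg in s0 *; have -> : S A = SP A - (mR - 2) * (SP A / (tau + 1)).
    by rewrite {1}e addrK.
  by field; rewrite t0' s0.
exists (fun u => X (inl u)); split=> [u||u]; first exact: X0.
(* A vector vanishing on the graph vertices has zero edge sums, hence vanishes at the new vertices
   too. *)
- case: z Xz => [u|q] Xz; first by exists u.
  apply/existsP/contraT; rewrite negb_exists => /forallP X_0; move: Xz.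
  rewrite Xr SPE ?(valP q.1)// /S big1 ?mul0r ?eqxx// => u _.
  by apply/eqP; have := X_0 u; rewrite negbK.
have := XE (inl u); rewrite (hadj_sum (power_linear G_unif)) hedges_power big_imset_cond; last first.
  by move=> A B _ _; exact: pedge_inj.
rewrite -/tau => e.
have -> : (sg + th) * X (inl u) = tau * X (inl u) * ((sg + 1) / (tau + 1)).
  by rewrite /th /sg in s0 *; field; rewrite t0'.
rewrite -e mulr_suml; apply: eq_big => [A|A /andP[AG uA]]; first by rewrite inE.
by rewrite -/(SP A) SPE// -/(S A) /th /sg in s0 *; field; rewrite t0' s0.
Qed.

End PowerTransfer.

(** * Comparison with the star *)

Lemma quad_psd (R : realFieldType) (A B x p : R) :
  0 < A -> 1 <= A * B -> 0 <= A * x ^+ 2 - 2 * x * p + B * p ^+ 2.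
Proof.
move=> A0 AB; rewrite -(pmulr_rge0 _ A0).
have -> : A * (A * x ^+ 2 - 2 * x * p + B * p ^+ 2) =
  (A * x - p) ^+ 2 + (A * B - 1) * p ^+ 2 by ring.
by rewrite addr_ge0 ?sqr_ge0// mulr_ge0 ?sqr_ge0// subr_ge0.
Qed.

(* The last condition is 6 <= k - 2 expressed through the equation
   sg (sg + th) = (k - 2) (1 + th sg) of the star with k - 2 edges. *)
Definition star_range (R : realFieldType) (th sg : R) : Prop :=
  [/\ 0 <= th, th < 1, 5 <= sg & 6 * (1 + th * sg) <= sg * (sg + th)].

Section StarBounds.
Variables (R : realFieldType) (th sg : R).
Hypothesis rng : star_range th sg.
Local Notation bt := (th + sg^-1).
Local Notation cmax := (2 * bt + 1 + th).
Implicit Types x p c : R.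

Lemma star_range_inv :
  [/\ sg * sg^-1 = 1, 0 < sg^-1, sg^-1 <= 5^-1 & 5 * th <= sg - 6 * sg^-1].
Proof.
have [th0 th1 sg5 sg_th] := rng; have sg0 : 0 < sg by lra.
have sgV : sg * sg^-1 = 1 by rewrite mulfV// gt_eqF.
split=> //; first by rewrite invr_gt0.
  by rewrite lef_pV2// posrE; lra.
rewrite -(ler_pM2l sg0).
have -> : sg * (sg - 6 * sg^-1) = sg * sg - 6 * (sg * sg^-1) by ring.
by rewrite sgV; lra.
Qed.

(** [cmax] is the most that one vertex can be charged: [2 bt] on behalf of the two vertices not
    adjacent to the root and [1 + th] on behalf of ab. Below [sg], the charge leaves the quadratic
    in the value of that vertex convex. *)
Lemma cmax_lt : cmax < sg.
Proof.
have [th0 th1 sg5 _] := rng; have [_ _ w5 h] := star_range_inv.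
by set w := sg^-1 in w5 h *; lra.
Qed.

(** The numerator is the total charge over all vertices, [2 bt] plus [1 + th] for each end of ab.
    The resulting loss must stay below the one [bt] by which two distant vertices overshoot the
    budget. *)
Lemma cmax_cost : (2 * bt + 2 + 2 * th) / (sg * (sg - cmax)) < bt.
Proof.
have [th0 th1 sg5 _] := rng; have [sgV sgV0 w5 h] := star_range_inv.
have K0 : 0 < sg - cmax by rewrite subr_gt0 cmax_lt.
rewrite ltr_pdivrMr ?mulr_gt0//; last by lra.
have -> : bt * (sg * (sg - cmax)) = (th * sg + sg * sg^-1) * (sg - cmax) by ring.
rewrite sgV; set w := sg^-1 in sgV sgV0 w5 h *.
have ts0 : 0 <= th * sg by rewrite mulr_ge0//; lra.
have : 0 <= (sg - 6 * w - 5 * th) * (th * sg) by rewrite mulr_ge0// subr_ge0.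
have -> : (sg - 6 * w - 5 * th) * (th * sg) =
  th * sg ^+ 2 - 6 * th * (sg * w) - 5 * th ^+ 2 * sg by ring.
have -> : (th * sg + 1) * (sg - (2 * (th + w) + 1 + th)) =
  th * sg ^+ 2 - th * sg - 2 * th * (sg * w) - 3 * th ^+ 2 * sg + sg - 2 * w - 1 - 3 * th by ring.
rewrite sgV => e1.
(* Together with [e1] scaled by 3/5, a fifth of this product leaves only
   [sg - 4 w - 3 - 2 th / 5 > 0], true for [sg >= 5]. *)
have : 0 <= th * ((sg - 5) * (2 * sg + 5)) by rewrite mulr_ge0// mulr_ge0; lra.
by lra.
Qed.

(** Completing the square gives the loss [c / (sg (sg - c))], since [1 / (sg - c) = 1 / sg + c / (sg
    (sg - c))]. With [cmax] in the denominator the bound becomes linear in [c], so only the total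
    charge matters in a sum. *)
Lemma own_cost x p c : 0 <= p <= 1 -> 0 <= c <= cmax ->
  - (c / (sg * (sg - cmax))) <= bt + sg * x ^+ 2 - 2 * x * p - th * p ^+ 2 - c * x ^+ 2.
Proof.
have [th0 th1 sg5 _] := rng; have [sgV sgV0 w5 h] := star_range_inv.
have sg0 : 0 < sg by lra.
move=> /andP[p0 p1] /andP[c0 cM]; have K0 : 0 < sg - cmax by rewrite subr_gt0 cmax_lt.
have d0 : 0 < sg - c by lra.
have q : 0 <= (sg - c) * x ^+ 2 - 2 * x * p + (sg - c)^-1 * p ^+ 2.
  by apply: quad_psd => //; rewrite mulfV// gt_eqF.
have e : (sg - c)^-1 = sg^-1 + c / (sg * (sg - c)).
  by field; rewrite !gt_eqF.
have le_c : c / (sg * (sg - c)) <= c / (sg * (sg - cmax)).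
  apply: ler_wpM2l => //; rewrite lef_pV2 ?posrE ?mulr_gt0//.
  by apply: ler_wpM2l; lra.
have q0 : 0 <= c / (sg * (sg - c)) by rewrite divr_ge0// mulr_ge0//; lra.
have p2 : p ^+ 2 <= 1 by rewrite expr_le1.
have : c / (sg * (sg - c)) * p ^+ 2 <= c / (sg * (sg - c)) * 1 by apply: ler_wpM2l.
have : bt * p ^+ 2 <= bt * 1 by apply: ler_wpM2l => //; lra.
rewrite e in q; lra.
Qed.

(** An end of ab passes half of [1 + th] on to its parent, so even two such vertices with a common
    parent charge it no more than [1 + th] on behalf of ab. *)
Lemma own_leaf x p (i : bool) :
  bt - (bt + i%:R * (1 + th) / 2) * p ^+ 2 <=
  bt + sg * x ^+ 2 - 2 * x * p - th * p ^+ 2 - (1 + th) * i%:R * x ^+ 2.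
Proof.
have [th0 th1 sg5 _] := rng; have [sgV sgV0 w5 h] := star_range_inv.
have : 0 <= (sg - (1 + th) * i%:R) * x ^+ 2 - 2 * x * p + (sg^-1 + i%:R * (1 + th) / 2) * p ^+ 2.
  set w := sg^-1 in sgV sgV0 w5 h *.
  apply: quad_psd; case: i => /=; rewrite ?mulr1 ?mulr0 ?mul0r ?mul1r ?subr0 ?addr0 ?sgV//; [lra|lra|nra].
lra.
Qed.

(** The middle value [x] absorbs both what the lower vertex passes up and its own ab-term; what is
    left of its coefficient suffices to charge only the top value [p]. Both flags at once would mean
    a tree edge equal to ab. *)
Lemma own_chain x p z (i j : bool) : ~~ (i && j) ->
  2 * bt - 2 * bt * p ^+ 2 <=
  (bt + sg * x ^+ 2 - 2 * x * p - th * p ^+ 2 - (1 + th) * i%:R * x ^+ 2) +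
  (bt + sg * z ^+ 2 - 2 * z * x - th * x ^+ 2 - (1 + th) * j%:R * z ^+ 2).
Proof.
have [th0 th1 sg5 _] := rng; have [sgV sgV0 w5 h] := star_range_inv.
move=> ij; have leaf := own_leaf z x j.
have q : 0 <= (sg - (bt + 1 + th)) * x ^+ 2 - 2 * x * p + (th + 2 * sg^-1) * p ^+ 2.
  set w := sg^-1 in sgV sgV0 w5 h *.
  by apply: quad_psd; [lra|nra].
have x2 : 0 <= x ^+ 2 by exact: sqr_ge0.
have : 0 <= (1 + th) * x ^+ 2 by apply: mulr_ge0 => //; lra.
case: i j ij leaf => [] [] //= _; rewrite ?mulr1 ?mulr0 ?mul0r ?mul1r; lra.
Qed.

End StarBounds.

(* A spanning tree rooted at v with parent map p, plus the edge ab avoiding v: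
   the index u <> v stands for the tree edge above u, and v stands for ab. *)
Definition uedge (V : finType) (v : V) (p : V -> V) (a b u : V) : {set V} :=
  if u == v then [set a; b] else [set u; p u].

Definition unistruct (V : finType) (v : V) (p : V -> V) (a b : V) : Prop :=
  [/\ a != b, a != v, b != v, forall u, u != v -> p u != u & injective (uedge v p a b)].

Section UniStruct.
Variables (V : finType) (v : V) (p : V -> V) (a b : V).
Hypothesis uni : unistruct v p a b.
Local Notation E := [set uedge v p a b u | u : V].

Lemma big_uedge (T : Type) (idx : T) (op : Monoid.com_law idx) (F : {set V} -> T) :
  \big[op/idx]_(e in E) F e =
  op (F [set a; b]) (\big[op/idx]_(u | u != v) F [set u; p u]).
Proof.
case: uni => _ _ _ _ inj; rewrite big_imset /=; last by move=> ? ? _ _ /inj.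
rewrite (bigD1 v)//= /uedge eqxx; congr (op _ _).
by apply: eq_bigr => u /negbTE ->.
Qed.

Lemma parent_neq2 u : u != v -> p u != v -> p (p u) != u.
Proof.
case: uni => _ _ _ pu inj uv puv; apply/eqP => ppu.
have /inj e : uedge v p a b u = uedge v p a b (p u).
  by rewrite /uedge (negbTE uv) (negbTE puv) ppu setUC.
by have := pu _ uv; rewrite -e eqxx.
Qed.

(** Otherwise the tree edge above [u] would be ab itself, against the injectivity of [uedge]. *)
Lemma parent_ab u : u != v -> u \in [set a; b] -> p u \notin [set a; b].
Proof.
case: uni => ab av bv pu inj uv uab; apply/negP => puab.
have /inj e : uedge v p a b u = uedge v p a b v.
  rewrite /uedge (negbTE uv) eqxx; apply/eqP; rewrite eqEcard !cards2 ab (eq_sym u) (pu _ uv).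
  by rewrite leqnn andbT; apply/subsetP => z; rewrite !in_set2 => /orP[]/eqP ->; rewrite -in_set2.
by rewrite e eqxx in uv.
Qed.

Lemma uedge_uniform e : e \in E -> #|e| = 2.
Proof.
case: uni => ab av bv pu inj /imsetP[u _ ->]; rewrite /uedge.
by case: eqP => [_|/eqP /pu puu]; rewrite cards2 ?ab// eq_sym puu.
Qed.

Lemma uedge_nonempty : set0 \notin E.
Proof. by apply/negP => /uedge_uniform; rewrite cards0. Qed.

Definition ugraph := Hypergraph uedge_nonempty.

End UniStruct.

Lemma qform2 (R : realFieldType) (T : finType) (th : R) (x : T -> R) u w : u != w ->
  qform th x [set u; w] = 2 * x u * x w + th * (x u ^+ 2 + x w ^+ 2).
Proof.
by move=> uw; rewrite /qform !big_setU1 ?inE//= !big_set1; ring.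
Qed.

(** * Two vertices not adjacent to the maximal one *)

Section TwoFar.
Variables (R : realFieldType) (V : finType) (v : V) (p : V -> V) (a b : V).
Variables (th sg : R) (x : V -> R).
Hypotheses (uni : unistruct v p a b) (rng : star_range th sg).
Hypothesis card_le : (#|V|%:R - 2) * (1 + th * sg) <= sg * (sg + th).
Hypotheses (x01 : forall u, 0 <= x u <= 1) (xv : x v = 1).
Hypothesis x_eq : (sg + th) * (\sum_u x u ^+ 2) =
  \sum_(e in [set uedge v p a b u | u : V]) qform th x e.
Local Notation bt := (th + sg^-1).
Local Notation cmax := (2 * bt + 1 + th).
Local Notation own := (fun u => bt + sg * x u ^+ 2 - 2 * x u * x (p u) - th * x (p u) ^+ 2).
Local Notation ab := (fun u => u \in [set a; b]).

(* Each own u is nonnegative when the values lie in [0, 1], being equal to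
   bt (1 - x_(p u)^2) + sg (x_u - x_(p u) / sg)^2 with bt = th + 1 / sg. *)
Lemma sum_own : \sum_(u | u != v) own u <=
  bt + (1 + th) * \sum_(u | u != v) (ab u)%:R * x u ^+ 2.
Proof.
have [th0 th1 sg5 _] := rng; have [sgV sgV0 _ _] := star_range_inv rng.
have [anb av bv pu _] := uni.
have ownE u : u != v ->
    own u = bt + (sg + th) * x u ^+ 2 - qform th x [set u; p u].
  by move=> uv; rewrite qform2 ?(eq_sym u) ?pu//; ring.
have -> : \sum_(u | u != v) (ab u)%:R * x u ^+ 2 = x a ^+ 2 + x b ^+ 2.
  under eq_bigr => u _ do rewrite mulr_natl mulrb.
  rewrite -big_mkcondr /= (eq_bigl (mem [set a; b])).
    by rewrite big_setU1 ?inE//= big_set1.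
  by move=> u /=; case: eqP => //= ->; rewrite !inE !(eq_sym v) (negbTE av) (negbTE bv).
rewrite (eq_bigr _ ownE) sumrB big_split /= sumr_const -mulr_sumr.
have cE : #|[pred u | u != v]| = (#|V| - 1)%N by rewrite subn1 -(cardC1 v).
have V0 : (0 < #|V|)%N by apply/card_gt0P; exists v.
rewrite cE -mulr_natr natrB//.
move: x_eq; rewrite (big_uedge uni) /= (bigD1 v)//= xv qform2// expr1n.
set S := \sum_(u | u != v) x u ^+ 2; set Q := \sum_(u | u != v) _; move=> e.
(* The root's share [sg + th] covers [#|V| - 2] copies of [bt], while the sum has [#|V| - 1] of
   them; this leaves the single [bt] of the bound. *)
have : bt * (#|V|%:R - 2) <= sg + th.
  have sg0 : 0 < sg by lra.
  rewrite -(ler_pM2l sg0) (_ : sg * _ = (#|V|%:R - 2) * (sg * sg^-1 + th * sg)); last by ring.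
  by rewrite sgV.
have : 0 <= (x a - x b) ^+ 2 by exact: sqr_ge0.
lra.
Qed.

(* Each of the two vertices y1, y2 off the star contributes bt up to a multiple
   c u of the square at its parent; these multiples and those coming from the
   edge ab are paid for by the terms own u of the other vertices. *)
Lemma cost_absurd (y1 y2 : V) (c : V -> R) (D := [pred u | [&& u != v, u != y1 & u != y2]]) :
  y1 != v -> y2 != v -> y1 != y2 ->
  (forall u, D u -> 0 <= c u + (1 + th) * (ab u)%:R <= cmax) ->
  \sum_(u | D u) (c u + (1 + th) * (ab u)%:R) <= 2 * bt + 2 + 2 * th ->
  2 * bt - \sum_(u | D u) c u * x u ^+ 2 <=
    (own y1 - (1 + th) * (ab y1)%:R * x y1 ^+ 2) +
    (own y2 - (1 + th) * (ab y2)%:R * x y2 ^+ 2) -> False.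
Proof.
have [th0 th1 sg5 _] := rng; have sg0 : 0 < sg by lra.
move=> y1v y2v y12 cM sum_c; apply/negP; rewrite -ltNge.
have := sum_own; rewrite (bigD1 y1)//= (bigD1 y2) /=; last by rewrite y2v eq_sym y12.
rewrite [in leRHS](bigD1 y1)//= [in leRHS](bigD1 y2) /=; last by rewrite y2v eq_sym y12.
have DE u : ((u != v) && (u != y1)) && (u != y2) = D u by rewrite /D /= andbA.
rewrite !(eq_bigl _ _ DE).
have lo : - (2 * bt + 2 + 2 * th) / (sg * (sg - cmax)) <=
    \sum_(u | D u) (own u - (c u + (1 + th) * (ab u)%:R) * x u ^+ 2).
  have K0 : 0 < (sg * (sg - cmax))^-1.
    by rewrite invr_gt0 mulr_gt0// subr_gt0 (cmax_lt rng).
  apply: (@le_trans _ _ (\sum_(u | D u) - ((c u + (1 + th) * (ab u)%:R) / (sg * (sg - cmax))))).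
    by rewrite sumrN -mulr_suml mulNr lerN2 ler_pM2r.
  by apply: ler_sum => u Du; apply: own_cost => //; exact: cM.
have := cmax_cost rng; rewrite mulNr in lo.
set C := (_ / _) in lo *; move=> C_lt.
have spl : \sum_(u | D u) (own u - (c u + (1 + th) * (ab u)%:R) * x u ^+ 2) =
  \sum_(u | D u) own u - \sum_(u | D u) c u * x u ^+ 2 -
  (1 + th) * \sum_(u | D u) (ab u)%:R * x u ^+ 2.
  by rewrite mulr_sumr -!sumrB; apply: eq_bigr => u _; ring.
rewrite {}spl in lo; lra.
Qed.

Lemma sum_ab (y1 y2 : V) : y1 != v -> y2 != v -> y1 != y2 ->
  \sum_(u | [&& u != v, u != y1 & u != y2]) (ab u)%:R + (ab y1)%:R + (ab y2)%:R = 2 :> R.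
Proof.
move=> y1v y2v y12; have [anb av bv _ _] := uni.
have : \sum_(u | u != v) (ab u)%:R = 2 :> R.
  under eq_bigr => u _ do rewrite mulrb.
  rewrite -big_mkcondr /= (eq_bigl (mem [set a; b])).
    by rewrite big_setU1 ?inE//= big_set1.
  by move=> u /=; case: eqP => //= ->; rewrite !inE !(eq_sym v) (negbTE av) (negbTE bv).
rewrite (bigD1 y1)//= (bigD1 y2) /=; last by rewrite y2v eq_sym y12.
under eq_bigl do rewrite -andbA.
by move=> <-; ring.
Qed.

Lemma sum_delta (y1 y2 w : V) (mu : R) (F : V -> R) :
  w != v -> w != y1 -> w != y2 ->
  \sum_(u | [&& u != v, u != y1 & u != y2]) mu * (u == w)%:R * F u = mu * F w.
Proof.
move=> wv w1 w2; rewrite (bigD1 w) /=; last by rewrite wv w1 w2.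
rewrite eqxx mulr1 big1 ?addr0// => u /andP[_ /negbTE ->].
by rewrite mulr0 mul0r.
Qed.

Lemma sum_delta1 (y1 y2 w : V) (mu : R) : w != v -> w != y1 -> w != y2 ->
  \sum_(u | [&& u != v, u != y1 & u != y2]) mu * (u == w)%:R = mu.
Proof.
move=> wv w1 w2; rewrite -[RHS]mulr1 -(@sum_delta y1 y2 w mu (fun=> 1))//.
by apply: eq_bigr => u _; rewrite mulr1.
Qed.

(** The charge of [y2] falls on [y1] and is absorbed by [own_chain]; the remaining [2 bt] goes to
    [p y1], which differs from both. *)
Lemma chain_absurd (y1 y2 : V) :
  y1 != v -> y2 != v -> y1 != y2 -> p y1 != v -> p y2 = y1 -> False.
Proof.
have [th0 th1 sg5 _] := rng; have [sgV sgV0 _ _] := star_range_inv rng.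
have [anb av bv pu _] := uni.
move=> y1v y2v y12 py1 py2.
have d1 : p y1 != y1 by exact: pu.
have d2 : p y1 != y2 by rewrite -py2; apply: (parent_neq2 uni); rewrite // py2.
apply: (@cost_absurd y1 y2 (fun u => 2 * bt * (u == p y1)%:R)) => //.
- move=> u _; case: (u == _); case: (ab u); rewrite /= ?mulr1 ?mulr0; lra.
- rewrite big_split /= -[X in _ + X]mulr_sumr.
  have := sum_ab y1v y2v y12; set s := \sum_(u | _) (ab u)%:R => es.
  rewrite sum_delta1//.
  have : 0 <= (1 + th) * ((ab y1)%:R + (ab y2)%:R).
    by apply: mulr_ge0; [lra|rewrite addr_ge0 ?ler0n].
  have -> : s = 2 - ((ab y1)%:R + (ab y2)%:R) by rewrite -es; ring.
  by lra.
rewrite sum_delta// py2; apply: (own_chain rng).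
apply/negP => /andP[i1 i2]; have := parent_ab uni y2v i2.
by rewrite py2 i1.
Qed.

(** Each of the two charges its own parent. The parents may coincide; the charge then stays within
    [cmax] because the parent of an end of ab is not an end of ab. *)
Lemma leaf_absurd (y1 y2 : V) :
  y1 != v -> y2 != v -> y1 != y2 -> p y1 != v -> p y2 != v -> p y1 != y2 -> p y2 != y1 -> False.
Proof.
have [th0 th1 sg5 _] := rng; have [sgV sgV0 _ _] := star_range_inv rng.
have [anb av bv pu _] := uni.
move=> y1v y2v y12 py1 py2 p12 p21.
have d1 : p y1 != y1 by exact: pu.
have d2 : p y2 != y2 by exact: pu.
pose mu y := bt + (ab y)%:R * (1 + th) / 2.
apply: (@cost_absurd y1 y2 (fun u => mu y1 * (u == p y1)%:R + mu y2 * (u == p y2)%:R)) => //.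
- move=> u _; rewrite /mu.
  have [->|_] := eqVneq u (p y1); have [e|_] := eqVneq _ (p y2); rewrite ?mulr1 ?mulr0.
  + have := parent_ab uni y1v; have := parent_ab uni y2v; rewrite -e.
    by case: (ab y1); case: (ab y2); case: (ab (p y1)) => /=; rewrite ?mul1r ?mulr1 ?mul0r ?mulr0;
      do 2?[move/(_ isT) => //] => *; lra.
  + have := parent_ab uni y1v.
    by case: (ab y1); case: (ab (p y1)) => /=; rewrite ?mul1r ?mulr1 ?mul0r ?mulr0;
      do 2?[move/(_ isT) => //] => *; lra.
  + have := parent_ab uni y2v; rewrite e.
    by case: (ab y2); case: (ab (p y2)) => /=; rewrite ?mul1r ?mulr1 ?mul0r ?mulr0;
      do 2?[move/(_ isT) => //] => *; lra.
  + by case: (ab u); rewrite ?mulr1 ?mulr0; lra.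
- rewrite !big_split /= -[X in _ + X]mulr_sumr.
  have := sum_ab y1v y2v y12; set s := \sum_(u | _) (ab u)%:R => es.
  rewrite !sum_delta1// /mu.
  have : 0 <= (1 + th) * ((ab y1)%:R + (ab y2)%:R).
    by apply: mulr_ge0; [lra|rewrite addr_ge0 ?ler0n].
  have -> : s = 2 - ((ab y1)%:R + (ab y2)%:R) by rewrite -es; ring.
  by lra.
under eq_bigr do rewrite mulrDl.
rewrite big_split /= !sum_delta//.
have := own_leaf rng (x y1) (x (p y1)) (ab y1).
have := own_leaf rng (x y2) (x (p y2)) (ab y2).
rewrite -!/(mu _); lra.
Qed.

Lemma two_far_absurd (y1 y2 : V) :
  y1 != v -> y2 != v -> y1 != y2 -> p y1 != v -> p y2 != v -> False.
Proof.
move=> y1v y2v y12 py1 py2.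
have [e|p21] := eqVneq (p y2) y1; first exact: (@chain_absurd y1 y2).
have [e|p12] := eqVneq (p y1) y2; first by apply: (@chain_absurd y2 y1) => //; rewrite eq_sym.
exact: (@leaf_absurd y1 y2).
Qed.

End TwoFar.

(** * The extremal graphs *)

(** A zero of a nonnegative solution forces zeros at all neighbours, so by connectedness the whole
    vector would vanish. *)
Lemma graph_eigen_pos (R : realType) (G : hypergraph) (th sg : R) (x : G -> R) :
  hconnected G -> (forall u, 0 <= x u) -> (exists u, x u != 0) -> graph_eigen th sg x ->
  forall u, 0 < x u.
Proof.
move=> G_conn x0 [u0 xu0] xE u; rewrite lt_def x0 andbT; apply: contra xu0 => xu.
have cl : closed (@hadj G) [pred z | x z == 0].
  apply: intro_closed; first exact/sym_connect_sym/hadj_sym.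
  move=> y z /andP[_ /existsP[e /and3P[eG ye ze]]]; rewrite !inE => /eqP xy.
  have := xE y; rewrite xy mulr0; under eq_bigr do rewrite mulr0 subr0.
  have S0 (f : {set G}) : 0 <= \sum_(v in f) x v by apply: sumr_ge0.
  move/esym/eqP; rewrite psumr_eq0// => /allP/(_ e); rewrite mem_index_enum => /(_ isT).
  rewrite eG ye /= psumr_eq0// => /allP/(_ z); rewrite mem_index_enum => /(_ isT).
  by rewrite ze.
by have := closed_connect cl (G_conn u u0); rewrite !inE xu => <-.
Qed.

Lemma sum_set2 (R : nmodType) (V : finType) (F : V -> R) a b : a != b ->
  \sum_(u in [set a; b]) F u = F a + F b.
Proof. by move=> ab; rewrite big_setU1 ?inE// big_set1. Qed.

Section Transplant.
Variables (R : realType) (m : nat) (V : finType).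
Hypothesis m_gt1 : (1 < m)%N.
Variables (v : V) (p : V -> V) (a b : V).
Hypothesis uni : unistruct v p a b.
Local Notation U := (ugraph uni).
Local Notation tau := ((m - 1)%:R * lambda1 R m (power_hypergraph m U)).
Local Notation sg := (tau - m%:R + 2).
Local Notation th := ((m%:R - 2) / (tau + 1)).

Lemma ugraph_uniform : huniform 2 U.
Proof. by move=> e /(uedge_uniform uni). Qed.

Lemma ugraph_perron : hconnected U -> 0 < sg ->
  exists2 x : V -> R, forall u, 0 < x u & @graph_eigen R U th sg x.
Proof.
move=> U_conn sg0; have U0 : (0 < #|U|)%N by apply/card_gt0P; exists v.
have [x [x0 xn0 xE]] := power_perron m_gt1 ugraph_uniform U0 sg0.
by exists x => // u; apply: graph_eigen_pos xE u.
Qed.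

(** The edge to the parent contributes [t * x u], which cancels against the same term of
    [(s + t) * x u]; hence the bare [s] on the left. *)
Lemma ugraph_eigen (t s : R) (x : V -> R) u : @graph_eigen R U t s x -> u != v ->
  s * x u = x (p u) + (u \in [set a; b])%:R * (x a + x b - (1 - t) * x u) +
     \sum_(u' | (u' != v) && (p u' == u)) (x u' + t * x u).
Proof.
have [ab av bv pu inj] := uni.
move=> /(_ u); rewrite big_mkcondr (big_uedge uni) /= => e uv.
apply: (addIr (t * x u)); rewrite -mulrDl e sum_set2//.
have upu : u != p u by rewrite eq_sym pu.
rewrite (bigD1 u)//= set21 sum_set2//.
have -> : (if u \in [set a; b] then x a + x b - (1 - t) * x u else 0) =
   (u \in [set a; b])%:R * (x a + x b - (1 - t) * x u).
  by rewrite mulr_natl mulrb.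
have -> : \sum_(i | (i != v) && (i != u))
    (if u \in [set i; p i] then \sum_(v0 in [set i; p i]) x v0 - (1 - t) * x u else 0) =
    \sum_(u' | (u' != v) && (p u' == u)) (x u' + t * x u).
  rewrite -big_mkcondr /=; apply: eq_big => [i|i].
    rewrite !inE (eq_sym u i) (eq_sym u (p i)); have [->|_] := eqVneq i v => //=.
    by have [->|_] := eqVneq i u; rewrite //= (negbTE (pu _ uv)).
  rewrite !inE => /andP[/andP[iv iu]]; rewrite (eq_sym u i) (negbTE iu) /= => /eqP ->.
  by rewrite sum_set2 1?eq_sym ?pu//; ring.
ring.
Qed.

End Transplant.

Arguments ugraph_uniform [V v p a b] uni e.

Section Shapes.
Variables (R : realType) (V : finType).

(* All vertices except w are adjacent to the root v, and w hangs from z. With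
   the additional edge ab this is UC_3(k-3) for z = v, UC_3(k-4,1) for z = a,
   U_3C(k-4) for z outside {v, a, b}, and for b = w the quadrangle v z w a with
   all other edges attached at v. *)
Definition shape_parent (v w z u : V) : V := if u == w then z else v.

Lemma shape_uni v w z a b : w != v -> z != w -> a != b -> a != v -> b != v ->
  [set z; w] != [set a; b] -> unistruct v (shape_parent v w z) a b.
Proof.
move=> wv zw ab av bv zwab; split=> // [u uv|u u'].
  by rewrite /shape_parent; have [->//|_] := eqVneq u w; rewrite eq_sym.
have nv (y : V) : y != v -> [set y; v] != [set a; b].
  move=> yv; apply/eqP => /setP/(_ v); rewrite !inE eqxx orbT !(eq_sym v).
  by rewrite (negbTE av) (negbTE bv).
have vz u1 : u1 != v -> u1 != w -> [set u1; v] != [set w; z].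
  move=> u1v u1w; apply/eqP => /setP/(_ w).
  by rewrite !inE eqxx (eq_sym w u1) (negbTE u1w) (negbTE wv).
have vv u1 u2 : u1 != v -> [set u1; v] = [set u2; v] -> u1 = u2.
  by move=> u1v /setP/(_ u1); rewrite !inE eqxx (negbTE u1v) !orbF => /esym/eqP.
rewrite /uedge /shape_parent.
have [->|uv] := eqVneq u v; have [->|u'v] := eqVneq u' v => //.
- case: eqP => [->|_] e; first by rewrite e setUC eqxx in zwab.
  by have := nv _ u'v; rewrite e eqxx.
- case: eqP => [->|_] e; first by rewrite -e setUC eqxx in zwab.
  by have := nv _ uv; rewrite e eqxx.
have [->|uw] := eqVneq u w; have [->|u'w] := eqVneq u' w => //.
- by move=> e; have := vz _ u'v u'w; rewrite -e eqxx.
- by move=> e; have := vz _ uv uw; rewrite e eqxx.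
exact: vv.
Qed.

Lemma shape_connected v w z a b (uni : unistruct v (shape_parent v w z) a b) :
  w != v -> hconnected (ugraph uni).
Proof.
move=> wv; have [_ _ _ pu _] := uni.
have vu u : u != w -> connect (@hadj (ugraph uni)) v u.
  move=> uw; have [->//|uv] := eqVneq u v; apply: connect1; rewrite /hadj /= eq_sym uv.
  apply/existsP; exists (uedge v (shape_parent v w z) a b u); rewrite imset_f//.
  by rewrite /uedge (negbTE uv) /shape_parent (negbTE uw) set21 set22.
have pw := pu _ wv; rewrite /shape_parent eqxx in pw.
have vw : connect (@hadj (ugraph uni)) v w.
  apply: connect_trans (vu z pw) _; apply: connect1; rewrite /hadj /= pw.
  apply/existsP; exists (uedge v (shape_parent v w z) a b w); rewrite imset_f//.
  by rewrite /uedge (negbTE wv) /shape_parent eqxx set21 set22.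
have all_v u : connect (@hadj (ugraph uni)) v u by have [->|/vu] := eqVneq u w.
move=> x y; apply: connect_trans (all_v y).
by rewrite sym_connect_sym//; exact: hadj_sym.
Qed.

Lemma shape_eigen v w z a b (uni : unistruct v (shape_parent v w z) a b) (t s : R) (x : V -> R) u :
  @graph_eigen R (ugraph uni) t s x -> w != v -> u != v ->
  s * x u = x (shape_parent v w z u) + (u \in [set a; b])%:R * (x a + x b - (1 - t) * x u) +
     (u == z)%:R * (x w + t * x u).
Proof.
move=> xE wv uv; rewrite (ugraph_eigen xE uv); congr (_ + _).
have [e|uz] := eqVneq u z; last first.
  rewrite big_pred0 ?mul0r// => u'; rewrite /shape_parent.
  by case: ifP => _; rewrite [X in _ && X]eq_sym ?(negbTE uz) ?(negbTE uv) andbF.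
rewrite mul1r -e (big_pred1 w)// => u' /=; rewrite /shape_parent.
  have [->|_] := eqVneq u' w; first by rewrite wv eqxx.
  by rewrite [X in _ && X]eq_sym (negbTE uv) andbF.
Qed.

End Shapes.

(** * The numerical range and the comparisons of extremal graphs *)

Section Regime.
Variables (R : realType) (m k : nat).
Hypotheses (m_gt1 : (1 < m)%N) (mk : (20 <= (k - 7) * (m - 1))%N).
Local Notation M := (m%:R : R).
Local Notation K := (k%:R : R).
Implicit Type tau : R.

(* The star with k - 2 edges satisfies sg tau = (k - 2) (m - 1). *)
Definition above_star tau : Prop :=
  0 < tau - M + 2 /\ (K - 2) * (M - 1) <= (tau - M + 2) * tau.

Lemma k_gt7 : (7 < k)%N.
Proof. by rewrite -subn_gt0; case: (k - 7)%N mk. Qed.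

Lemma above_starP tau (sg := tau - M + 2) (th := (M - 2) / (tau + 1)) :
  above_star tau -> star_range th sg /\ (K - 2) * (1 + th * sg) <= sg * (sg + th).
Proof.
case; rewrite -/sg => sg0 le_st.
have M2 : 2 <= M by rewrite ler_nat.
have K8 : 8 <= K by rewrite ler_nat k_gt7.
have MK : 20 <= (K - 7) * (M - 1).
  by move: mk; rewrite -(ler_nat R) natrM !natrB// ltnW// k_gt7.
have tE : tau = sg + M - 2 by rewrite /sg; ring.
have t1 : 0 < tau + 1 by lra.
have th0 : 0 <= th by rewrite divr_ge0//; lra.
have th1 : th < 1 by rewrite ltr_pdivrMr//; lra.
(* If [sg < 5], then [sg tau < 5 (m + 3) = 5 (m - 1) + 20], whereas [(k - 2) (m - 1) = 5 (m - 1) +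
   (k - 7) (m - 1)] is at least that. This is the origin of 7 and 20. *)
have sg5 : 5 <= sg.
  rewrite leNgt; apply/negP => sg5.
  have : sg * tau < 5 * (5 + M - 2) by rewrite tE; nra.
  lra.
(* With [q = (sg + 1) / (tau + 1)] one has [1 + th sg = (m - 1) q] and [sg + th = tau q]. *)
have ge_k (c : R) : c * (M - 1) <= sg * tau -> c * (1 + th * sg) <= sg * (sg + th).
  move=> le_c; have q0 : 0 <= (sg + 1) / (tau + 1) by rewrite divr_ge0//; lra.
  have -> : c * (1 + th * sg) = c * (M - 1) * ((sg + 1) / (tau + 1)).
    by rewrite /th tE; field; rewrite -tE gt_eqF.
  have -> : sg * (sg + th) = sg * tau * ((sg + 1) / (tau + 1)).
    by rewrite /th tE; field; rewrite -tE gt_eqF.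
  exact: ler_wpM2r.
split; last exact: ge_k.
split=> //; apply: ge_k; apply: le_trans le_st; apply: ler_wpM2r; lra.
Qed.

End Regime.

Section Comparisons.
Variables (R : realType) (m k : nat) (V : finType).
Hypotheses (m_gt1 : (1 < m)%N) (mk : (20 <= (k - 7) * (m - 1))%N) (cardV : #|V| = k).
Local Notation M := (m%:R : R).
Local Notation K := (k%:R : R).
Local Notation lam uni := (lambda1 R m (power_hypergraph m (ugraph uni))).
Local Notation tau uni := ((m - 1)%:R * lam uni).

(** As [th] and [sg] are frozen at the values of [uni], common edges contribute equally and only the
    exchanged edges matter. *)
Lemma transplant_lt v p a b v' p' a' b' (uni : @unistruct V v p a b) (uni' : @unistruct V v' p' a' b')
    (x : V -> R) (th := (M - 2) / (tau uni + 1)) (sg := tau uni - M + 2) :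
  0 < sg -> @graph_eigen R (ugraph uni) th sg x ->
  \sum_(e in hedges (ugraph uni)) qform th x e < \sum_(e in hedges (ugraph uni')) qform th x e ->
  lam uni < lam uni'.
Proof.
move=> sg0 xE lt_q.
have m0 : 0 < (m - 1)%:R :> R by rewrite ltr0n subn_gt0.
rewrite -(ltr_pM2l m0). apply: (power_lower m_gt1 (ugraph_uniform uni') (x := x)) => //.
by rewrite (graph_eigen_qform xE).
Qed.

Lemma shape_sum (v w z a b : V) (uni : unistruct v (shape_parent v w z) a b) (F : {set V} -> R) :
  w != v ->
  \sum_(e in hedges (ugraph uni)) F e =
  F [set a; b] + F [set w; z] + \sum_(u | (u != v) && (u != w)) F [set u; v].
Proof.
move=> wv; rewrite (big_uedge uni) /= -addrA; congr (_ + _).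
rewrite (bigD1 w)//= /shape_parent eqxx; congr (_ + _).
by apply: eq_bigr => u /andP[_ /negbTE ->].
Qed.

(* The test vector is the Perron vector of the star formed by v and its
   neighbours other than w, extended by 0. *)
Lemma star_lt (v w z a b : V) (uni : unistruct v (shape_parent v w z) a b) (t : R) :
  w != v -> a != w -> b != w -> 0 < t - M + 2 -> (t - M + 2) * t <= (K - 2) * (M - 1) ->
  t < tau uni.
Proof.
move=> wv aw bw sg0 le_t; have [ab av bv pu inj] := uni.
have M2 : 2 <= M by rewrite ler_nat.
have K8 : 8 <= K by rewrite ler_nat (k_gt7 mk).
pose x u : R := if u == v then t - M + 2 else if u == w then 0 else 1.
apply: (power_lower m_gt1 (ugraph_uniform uni) (x := x)) => //.
rewrite shape_sum//; set th := (M - 2) / (t + 1); set sg := t - M + 2 in sg0 le_t x *.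
have xv : x v = sg by rewrite /x eqxx.
have xw : x w = 0 by rewrite /x eqxx (negbTE wv).
have x1 u : u != v -> u != w -> x u = 1 by rewrite /x => /negbTE -> /negbTE ->.
have t1 : 0 < t + 1 by rewrite /sg in sg0; lra.
have th0 : 0 <= th by rewrite divr_ge0//; lra.
have pw := pu _ wv; rewrite /shape_parent eqxx in pw.
have cD : #|[pred u | (u != v) && (u != w)]| = (k - 2)%N.
  rewrite -cardV -(cardC (pred2 v w)) card2 (eq_sym v) wv addKn.
  by apply: eq_card => u; rewrite !inE negb_or.
have kE : (k - 2)%:R = K - 2 by rewrite natrB//; exact: ltn_trans (k_gt7 mk).
rewrite (bigD1 v)//= (bigD1 w)//= xv xw.
rewrite (eq_bigr (fun=> 1)); last by move=> u /andP[uv uw]; rewrite x1// expr1n.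
rewrite [X in _ < _ + X](eq_bigr (fun=> 2 * sg + th * (1 + sg ^+ 2))); last first.
  by move=> u /andP[uv uw]; rewrite qform2// xv x1//; ring.
have sumE (c : R) : \sum_(u | (u != v) && (u != w)) c = c * (K - 2).
  by rewrite sumr_const cD -kE mulr_natr.
rewrite !sumE qform2// qform2 1?eq_sym// xw (x1 a av aw) (x1 b bv bw).
have : 0 <= th * x z ^+ 2 by rewrite mulr_ge0// sqr_ge0.
have : sg * (sg + th) <= (K - 2) * (1 + th * sg).
  have tE : t = sg + M - 2 by rewrite /sg; ring.
  have q0 : 0 <= (sg + 1) / (t + 1) by rewrite divr_ge0//; lra.
  have -> : (K - 2) * (1 + th * sg) = (K - 2) * (M - 1) * ((sg + 1) / (t + 1)).
    by rewrite /th tE; field; rewrite -tE gt_eqF.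
  have -> : sg * (sg + th) = sg * t * ((sg + 1) / (t + 1)).
    by rewrite /th tE; field; rewrite -tE gt_eqF.
  exact: ler_wpM2r.
(* By [e1] the star edges already reach the left side; strictness comes from ab, whose form is
   [2 + 2 th] here. *)
rewrite -(ler_pM2l sg0) => e1 e2.
have -> : (sg + th) * (sg ^+ 2 + (0 ^+ 2 + 1 * (K - 2))) =
   sg * (sg * (sg + th)) + (sg + th) * (K - 2) by ring.
lra.
Qed.

(** Meant for the [tau] of an arbitrary graph: either that graph already loses to [uni], or the
    estimates of the range above the star apply to it. *)
Lemma above_or_below (v w z a b : V) (uni : unistruct v (shape_parent v w z) a b) (t : R) :
  w != v -> a != w -> b != w -> above_star m k t \/ t < tau uni.
Proof.
move=> wv aw bw.
have M2 : 2 <= M by rewrite ler_nat.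
have K8 : 8 <= K by rewrite ler_nat (k_gt7 mk).
have [sg0|sg0] := ltP 0 (t - M + 2); last first.
  (* Here [t <= m - 2], and [star_lt] applies to the larger value [m - 1], for which [sg] becomes
     1. *)
  right; apply: (@lt_trans _ _ (M - 1)); first lra.
  apply: (star_lt uni) => //; first by lra.
  have -> : (M - 1 - M + 2) * (M - 1) = 1 * (M - 1) by ring.
  by apply: ler_wpM2r; lra.
have [le_t|/ltW le_t] := leP ((K - 2) * (M - 1)) ((t - M + 2) * t); first by left.
by right; apply: (star_lt uni).
Qed.

Lemma above_self (v w z a b : V) (uni : unistruct v (shape_parent v w z) a b) :
  w != v -> a != w -> b != w -> above_star m k (tau uni).
Proof. by move=> wv aw bw; have [//|] := above_or_below uni (tau uni) wv aw bw; rewrite ltxx. Qed.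

Lemma lambda_lt12 (v w a b : V) (uni : unistruct v (shape_parent v w v) a b)
    (uni' : unistruct v (shape_parent v w a) a b) :
  w != v -> a != w -> b != w -> lam uni' < lam uni.
Proof.
move=> wv aw bw; have [ab av bv _ _] := uni.
have [[th0 th1 sg5 _] _] := above_starP m_gt1 mk (above_self uni' wv aw bw).
have sg0 : 0 < tau uni' - M + 2 by lra.
have [x x0 xE] := ugraph_perron m_gt1 (shape_connected (uni := uni') wv) sg0.
apply: (transplant_lt sg0 xE); rewrite !shape_sum// ltrD2r ltrD2l !qform2// 1?eq_sym//.
have := shape_eigen xE wv av; have := shape_eigen xE wv bv; have := shape_eigen xE wv wv.
rewrite /shape_parent (negbTE aw) (negbTE bw) !inE !eqxx (eq_sym w a) (negbTE aw) (eq_sym w b) (negbTE bw).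
rewrite (eq_sym b a) (negbTE ab) !mul0r !addr0 !mul1r.
set th := (M - 2) / _ in th0 th1 *; set sg := (tau uni' - M + 2) in sg5 sg0 *.
have xv0 := x0 v; have xa0 := x0 a; have xb0 := x0 b; have xw0 := x0 w.
move=> ew eb ea.
(* If [x v <= x a], then b and w carry at most a half and a fifth of [x a], so
   [(sg - 2 th) x a <= 1.7 x a], although [sg - 2 th > 3]. *)
have lt_av : x a < x v.
  rewrite ltNge; apply/negP => le_va.
  have hb : x b <= x a / 2 by nra.
  have hw : x w <= x a / 5 by nra.
  nra.
have : 0 <= th * (x v ^+ 2 - x a ^+ 2) by apply: mulr_ge0 => //; nra.
have : 0 < x w * (x v - x a) by apply: mulr_gt0 => //; lra.
lra.
Qed.

Lemma lambda_lt23 (v w z a b : V) (uni : unistruct v (shape_parent v w a) a b)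
    (uni' : unistruct v (shape_parent v w z) a b) :
  w != v -> a != w -> b != w -> z != v -> z != a -> z != b -> lam uni' < lam uni.
Proof.
move=> wv aw bw zv za zb; have [ab av bv _ _] := uni.
have [_ _ _ pu _] := uni'; have zw := pu _ wv; rewrite /shape_parent eqxx in zw.
have [[th0 th1 sg5 _] _] := above_starP m_gt1 mk (above_self uni' wv aw bw).
have sg0 : 0 < tau uni' - M + 2 by lra.
have [x x0 xE] := ugraph_perron m_gt1 (shape_connected (uni := uni') wv) sg0.
apply: (transplant_lt sg0 xE); rewrite !shape_sum// ltrD2r ltrD2l !qform2// 1?eq_sym//.
have z_ab : z \in [set a; b] = false by rewrite !inE (negbTE za) (negbTE zb).
have w_ab : w \in [set a; b] = false by rewrite !inE !(eq_sym w) (negbTE aw) (negbTE bw).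
have := shape_eigen xE wv av; have := shape_eigen xE wv bv.
have := shape_eigen xE wv zv; have := shape_eigen xE wv wv.
rewrite /shape_parent (negbTE aw) (negbTE bw) (negbTE zw) !eqxx set21 set22 z_ab w_ab.
rewrite (eq_sym a z) (negbTE za) (eq_sym b z) (negbTE zb) (eq_sym w z) (negbTE zw).
rewrite !mul0r !addr0 !mul1r.
set th := (M - 2) / _ in th0 th1 *; set sg := (tau uni' - M + 2) in sg5 sg0 *.
have xv0 := x0 v; have xa0 := x0 a; have xb0 := x0 b; have xw0 := x0 w; have xz0 := x0 z.
move=> ew ez eb ea.
(* Besides v, the vertex a sees b with [x b = x a], while z sees only w with [x w = x z / sg]. *)
have lt_za : x z < x a.
  rewrite ltNge; apply/negP => le_az.
  have eab : x a = x b by nra.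
  have hw : x w <= x z / 5 by nra.
  nra.
have : 0 <= th * (x a ^+ 2 - x z ^+ 2) by apply: mulr_ge0 => //; nra.
have : 0 < x w * (x a - x z) by apply: mulr_gt0 => //; lra.
lra.
Qed.

(** [uniC] contains the quadrangle v z w a; its edges aw and wz are exchanged for az and wy. The
    range is assumed because [above_self] does not cover an extra edge ending in w. *)
Lemma lambda_lt3C (v w z a y : V) (uniC : unistruct v (shape_parent v w z) a w)
    (uni : unistruct v (shape_parent v w y) a z) :
  w != v -> a != w -> z != v -> z != a -> y != v -> y != a -> y != z ->
  above_star m k (tau uniC) -> lam uniC < lam uni.
Proof.
move=> wv aw zv za yv ya yz above; have [_ av _ pu _] := uniC.
have [_ _ _ pu' _] := uni; have yw := pu' _ wv; rewrite /shape_parent eqxx in yw.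
have zw := pu _ wv; rewrite /shape_parent eqxx in zw.
have [[th0 th1 sg5 _] _] := above_starP m_gt1 mk above.
have sg0 : 0 < tau uniC - M + 2 by lra.
have [x x0 xE] := ugraph_perron m_gt1 (shape_connected (uni := uniC) wv) sg0.
apply: (transplant_lt sg0 xE); rewrite !shape_sum// ltrD2r !qform2// 1?eq_sym//.
have z_aw : z \in [set a; w] = false by rewrite !inE (negbTE za) (negbTE zw).
have y_aw : y \in [set a; w] = false by rewrite !inE (negbTE ya) (negbTE yw).
have := shape_eigen xE wv av; have := shape_eigen xE wv wv.
have := shape_eigen xE wv zv; have := shape_eigen xE wv yv.
rewrite /shape_parent (negbTE aw) (negbTE yw) (negbTE zw) !eqxx set21 set22 z_aw y_aw.
rewrite (eq_sym a z) (negbTE za) (eq_sym w z) (negbTE zw) (negbTE yz).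
rewrite !mul0r !addr0 !mul1r.
set th := (M - 2) / _ in th0 th1 *; set sg := (tau uniC - M + 2) in sg5 sg0 *.
have xv0 := x0 v; have xa0 := x0 a; have xw0 := x0 w; have xz0 := x0 z; have xy0 := x0 y.
move=> ey ez ew ea.
have eaz : x z = x a by nra.
have haw : 2 * x w <= x a by nra.
have lt_wy : x w <= x y.
  (* Eliminates [x a] between [(sg - th) x w = 2 x a] and [(sg - th) x a = x v + x w], with
     [x v = sg x y]. *)
  have q1 : ((sg - th) ^+ 2 - 2) * x w = 2 * (sg * x y) by nra.
  have q2 : 2 * sg <= (sg - th) ^+ 2 - 2 by nra.
  nra.
rewrite eaz.
have : 0 <= th * (x y ^+ 2 - x w ^+ 2) by apply: mulr_ge0 => //; nra.
have : 0 < x w * x y by apply: mulr_gt0.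
have : 0 <= x a * (x a - 2 * x w) by apply: mulr_ge0 => //; lra.
lra.
Qed.

End Comparisons.

Local Close Scope ring_scope.

(** * Loose cycles and spanning trees *)

Section GraphCycles.
Variables (m : nat) (G : hypergraph).
Hypothesis G_unif : huniform 2 G.

Lemma ordS_neq l (i : 'I_l) : 1 < l -> ordS i != i.
Proof.
move=> l1; apply/eqP => /(congr1 val) /=; case: (ltngtP i.+1 l) => [lt|gt|e].
- by rewrite modn_small// => /eqP; rewrite eqn_leq ltnn.
- by have := leq_trans gt (ltn_ord i); rewrite ltnn.
- by rewrite e modnn => i0; rewrite -i0 in e; rewrite -e in l1.
Qed.

Lemma ordSS_neq l (i : 'I_l) : 2 < l -> ordS (ordS i) != i.
Proof.
move=> l2; apply/eqP => /(congr1 val) /=; rewrite -addn1 modnDml addn1.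
case: (ltngtP i.+2 l) => [lt|gt|e].
- by rewrite modn_small// => /eqP; rewrite eqn_leq ltnNge leqnSn.
- have e : i.+1 = l by apply/eqP; rewrite eqn_leq ltn_ord.
  rewrite -addn1 e addnC modnDr modn_small ?(ltnW l2)// => i1.
  by rewrite -e -i1 in l2.
- by rewrite e modnn => i0; rewrite -i0 in e; rewrite -e in l2.
Qed.

Lemma graph_cycle_loose l (c : 'I_l -> G) : 2 < l -> injective c ->
  is_loose_cycle [set pedge m [set c i; c (ordS i)] | i : 'I_l].
Proof.
move=> l2 c_inj; have l1 := ltnW l2.
exists l, (fun i => inl (c i)), (fun i => pedge m [set c i; c (ordS i)]); split=> //.
- by move=> i j [/c_inj].
- move=> i; rewrite pedgeI.
    apply/setP => z; rewrite in_set1; apply/imsetP/eqP => [[x]|->].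
      rewrite !inE => /andP[/orP[]/eqP -> /orP[]/eqP].
      + by move/c_inj/eqP; rewrite eq_sym (negbTE (ordS_neq _ l1)).
      + by move/c_inj/eqP; rewrite eq_sym (negbTE (ordSS_neq _ l2)).
      + by move=> _ ->.
      + by move/c_inj/eqP; rewrite eq_sym (negbTE (ordS_neq _ l1)).
    by exists (c (ordS i)); rewrite // !inE !eqxx orbT.
  apply/eqP => /setP/(_ (c i)); rewrite !inE eqxx !(inj_eq c_inj).
  by rewrite eq_sym (negbTE (ordS_neq _ l1)) eq_sym (negbTE (ordSS_neq _ l2)).
- move=> i j ji jSi iSj; rewrite -setI_eq0 pedgeI.
    apply/eqP/setP => z; rewrite in_set0; apply/negbTE/imsetP => -[x].
    rewrite !inE => /andP[/orP[]/eqP -> /orP[]/eqP /c_inj/eqP].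
    + by rewrite eq_sym (negbTE ji).
    + by rewrite (negbTE iSj).
    + by rewrite eq_sym (negbTE jSi).
    + by rewrite (inj_eq (@ordS_inj _)) eq_sym (negbTE ji).
  apply/eqP => /setP/(_ (c i)); rewrite !inE eqxx !(inj_eq c_inj).
  by rewrite (eq_sym i j) (negbTE ji) (negbTE iSj).
Qed.

Lemma loose_cycle_graph (C : {set {set power_hypergraph m G}}) :
  C \subset hedges (power_hypergraph m G) -> is_loose_cycle C ->
  exists l (c : 'I_l -> G), [/\ 2 < l, injective c,
    forall i, [set c i; c (ordS i)] \in hedges G
    & C = [set pedge m [set c i; c (ordS i)] | i : 'I_l]].
Proof.
move=> CE [l [v [e [l2 v_inj eI _ CD]]]]; have l1 := ltnW l2.
have eE i : exists2 A, A \in hedges G & e i = pedge m A.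
  have : e i \in hedges (power_hypergraph m G) by apply: (subsetP CE); rewrite CD imset_f.
  by rewrite hedges_power => /imsetP[A AG ->]; exists A.
have vS i : v (ordS i) \in e i.
  by have := set11 (v (ordS i)); rewrite -eI => /setIP[].
have vI i : v i \in e i.
  have := set11 (v i); rewrite -{2}(ord_predK i) -eI => /setIP[_].
  by rewrite ord_predK.
(* A new vertex lies in a single edge; as a meeting point it would make [e i] and [e (ordS i)]
   equal, and their intersection would also contain [v i]. *)
have inlS i : exists x, v (ordS i) = inl x.
  case vE : (v (ordS i)) => [x|q]; first by exists x.
  have := set11 (v (ordS i)); rewrite -eI => /setIP[].
  have [A _ eA] := eE i; have [B _ eB] := eE (ordS i).
  rewrite vE eA eB !inE => /eqP qA /eqP qB.
  have := vI i; rewrite -[e i]setIid {2}eA -qA qB -eB eI inE => /eqP/v_inj/eqP.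
  by rewrite eq_sym (negbTE (ordS_neq _ l1)).
have inlI i : exists x, v i = inl x by rewrite -(ord_predK i).
have [c vc] := fin_all_exists inlI.
have c_inj : injective c by move=> i j ij; apply: v_inj; rewrite !vc ij.
have eA i : e i = pedge m [set c i; c (ordS i)] /\ [set c i; c (ordS i)] \in hedges G.
  have [A AG eA] := eE i; suff -> : [set c i; c (ordS i)] = A by [].
  apply/eqP; rewrite eqEcard (G_unif AG) cards2 (inj_eq c_inj) eq_sym ordS_neq//= andbT.
  apply/subsetP => x; rewrite !inE => /orP[]/eqP ->.
    by have := vI i; rewrite vc eA inE.
  by have := vS i; rewrite vc eA inE.
exists l, c; split=> // [i|]; first by have [] := eA i.
by rewrite CD; apply: eq_imset => i; have [] := eA i.
Qed.

End GraphCycles.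

Lemma connected_parent (G : hypergraph) (v : G) : hconnected G ->
  exists (p : G -> G) (r : G -> nat), forall u, u != v ->
    [/\ hadj u (p u), r (p u) < r u & hadj u v -> p u = v].
Proof.
move=> G_conn; pose reach u n := [exists t : n.-tuple G, path (@hadj G) v t && (last v t == u)].
have ex u : exists n, reach u n.
  have /connectP[t vt ->] := G_conn v u.
  by exists (size t); apply/existsP; exists (in_tuple t); rewrite vt eqxx.
pose r u := ex_minn (ex u).
have r_min u n : reach u n -> r u <= n by rewrite /r; case: ex_minnP => k _; apply.
have step u : u != v -> exists2 y, hadj u y & r y < r u.
  move=> uv; rewrite {2}/r; case: ex_minnP => n /existsP[t].
  case: n t => [|n] t /andP[vt /eqP tu].
    by move: uv; rewrite -tu (tuple0 t) eqxx.
  move=> _; have t0 : 0 < size t by rewrite size_tuple.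
  move: vt tu; case/lastP: (tval t) (size_tuple t) => [//|s z]; rewrite size_rcons => -[sn].
  rewrite rcons_path last_rcons => /andP[vs yz] zu; rewrite -{}zu in yz uv *.
  exists (last v s); first by rewrite hadj_sym.
  rewrite ltnS; apply: r_min; rewrite -sn; apply/existsP; exists (in_tuple s).
  by rewrite vs eqxx.
pose p u := if hadj u v then v else odflt u [pick y | hadj u y && (r y < r u)].
exists p, r => u uv; have [y uy ry] := step u uv.
have r_v : r v = 0.
  by apply/eqP; rewrite -leqn0; apply: r_min; apply/existsP; exists [tuple]; rewrite /= eqxx.
rewrite /p; case: ifP => [uv_adj|_]; first by split=> //; rewrite r_v (leq_ltn_trans _ ry).
by case: pickP => [z /andP[] //|/(_ y)]; rewrite uy ry.
Qed.

Section Structure.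
Variables (m : nat) (G : hypergraph).
Hypothesis G_unif : huniform 2 G.
Local Notation P := (power_hypergraph m G).

Lemma graph_adj (x y : G) : hadj x y -> [set x; y] \in hedges G.
Proof.
case/andP=> xy /existsP[e /and3P[eG xe ye]].
suff -> : [set x; y] = e by [].
apply/eqP; rewrite eqEcard (G_unif eG) cards2 xy andbT.
by apply/subsetP => z; rewrite !inE => /orP[]/eqP ->.
Qed.

Lemma power_connected_graph : hconnected P -> hconnected G.
Proof.
move=> P_conn x y; pose S := [pred z : P | match z with
  | inl u => connect (@hadj G) x u
  | inr q => [exists u in val q.1, connect (@hadj G) x u] end].
have cl : closed (@hadj P) S.
  apply: intro_closed; first exact/sym_connect_sym/hadj_sym.
  have inA A (AG : A \in hedges G) z : z \in pedge m A -> S z -> exists2 u, u \in A & connect (@hadj G) x u.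
    case: z => [u|q]; rewrite inE /=; first by exists u.
    by move=> /eqP <- /existsP[u /andP[uA xu]]; exists u.
  move=> z1 z2 /andP[_ /existsP[e /and3P[]]]; rewrite hedges_power => /imsetP[A AG ->] z1A z2A Sz1.
  have [u uA xu] := inA A AG z1 z1A Sz1.
  case: z2 z2A => [w|q]; rewrite inE /=; last first.
    by move=> /eqP qA; rewrite inE /= qA; apply/existsP; exists u; rewrite uA.
  move=> wA; rewrite inE /=; have [<-//|uw] := eqVneq u w.
  apply: connect_trans xu (connect1 _); rewrite /hadj /= uw.
  by apply/existsP; exists A; rewrite AG uA wA.
have := closed_connect cl (P_conn (inl x) (inl y)).
by rewrite !inE /= connect0 => <-.
Qed.

Lemma graph_connected_power : hconnected G -> hconnected P.
Proof.
move=> G_conn.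
have up x y : connect (@hadj G) x y -> connect (@hadj P) (inl x) (inl y).
  case/connectP => s; elim: s x => [|z s IHs] x /=; first by move=> _ ->.
  case/andP => /andP[xz /existsP[e /and3P[eG xe ze]]] zs /(IHs _ zs).
  apply: connect_trans; apply: connect1; rewrite /hadj /= (inj_eq (@inl_inj _ _)) xz.
  apply/existsP; exists (pedge m e); rewrite !inE xe ze /= andbT.
  by have := hedges_power m G; rewrite /= => ->; exact: imset_f.
have down z : exists x, connect (@hadj P) (inl x) z.
  case: z => [x|[[A AG] j]]; first by exists x.
  have : A != set0 by rewrite -card_gt0 (G_unif AG).
  case/set0Pn => x xA; exists x; apply: connect1; rewrite /hadj /=.
  apply/existsP; exists (pedge m A); rewrite !inE xA eqxx /= andbT.
  by have := hedges_power m G; rewrite /= => ->; exact: imset_f.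
move=> z1 z2; have [x xz1] := down z1; have [y yz2] := down z2.
apply: connect_trans (connect_trans (up x y (G_conn x y)) yz2).
by rewrite sym_connect_sym//; exact: hadj_sym.
Qed.

(* p comes from a breadth-first search, so all edges at v are tree edges; each
   edge off the tree closes a loose cycle containing no other such edge. *)
Lemma unicyclic_structure (v : G) : hconnected G ->
  (exists! C : {set {set P}}, C \subset hedges P /\ is_loose_cycle C) ->
  exists p a b, unistruct v p a b /\ hedges G = [set uedge v p a b u | u : G].
Proof.
move=> G_conn [C0 [[C0E C0_cyc] C0_uniq]].
have [p [r pr]] := connected_parent v G_conn.
have pE u : u != v -> [set u; p u] \in hedges G by case/pr => /graph_adj.
have pu u : u != v -> p u != u.
  by move=> /pr[_ lt _]; apply: contraTneq lt => ->; rewrite ltnn.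
pose tree (A : {set G}) := [exists u, (u != v) && (A == [set u; p u])].
pose T := [rel x y : G | tree [set x; y]].
have T_sym : symmetric T by move=> x y; rewrite /T /= setUC.
have Tp u : u != v -> T u (p u) by move=> uv; apply/existsP; exists u; rewrite uv eqxx.
have T_conn x : connect T x v.
  have [n] := ubnP (r x); elim: n x => // n IHn x; rewrite ltnS => le_n.
  have [->//|xv] := eqVneq x v; have [_ lt _] := pr x xv.
  by apply: connect_trans (connect1 (Tp _ xv)) (IHn _ (leq_trans lt le_n)).
have fundamental A : A \in hedges G -> ~~ tree A -> exists C : {set {set P}},
    [/\ C \subset hedges P, is_loose_cycle C, pedge m A \in C
      & forall B, pedge m B \in C -> B = A \/ tree B].
  move=> AG treeA; have : #|A| == 2 by rewrite (G_unif AG).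
  case/cards2P => a [b [ab eA]].
  rewrite {}eA in AG treeA *.
  have : connect T a b.
    by apply: connect_trans (T_conn a) _; rewrite sym_connect_sym.
  case/connectP => q0 /shortenP[q aq aq_uniq _] bE.
  (* As ab is not a tree edge, the tree path from a to b has at least two edges, and closing it
     gives a cycle of length at least 3. *)
  have q2 : 1 < size q.
    case: q aq {aq_uniq} bE => [|b' [|//]] /=; first by move=> _ ba; rewrite ba eqxx in ab.
    by rewrite andbT => ab' bb'; rewrite bb' ab' in treeA.
  pose c (i : 'I_(size q).+1) := nth a (a :: q) i.
  have c_inj : injective c.
    by move=> i j /eqP; rewrite nth_uniq//= => /eqP; exact: val_inj.
  have cE i : [set c i; c (ordS i)] = [set a; b] \/ tree [set c i; c (ordS i)].
    have [i_lt|i_ge] := ltnP i (size q).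
      right; rewrite /c /= modn_small//=.
      by have /(pathP a)/(_ _ i_lt) := aq.
    have iE : i = size q :> nat by apply/eqP; rewrite eqn_leq i_ge -ltnS ltn_ord.
    by left; rewrite /c /= iE modnn /= bE -last_nth setUC.
  exists [set pedge m [set c i; c (ordS i)] | i : 'I_(size q).+1]; split.
  - apply/subsetP => _ /imsetP[i _ ->]; rewrite hedges_power imset_f//.
    by case: (cE i) => [->//|/existsP[u /andP[uv /eqP ->]]]; exact: pE.
  - exact: graph_cycle_loose.
  - apply/imsetP; exists ord_max => //; congr pedge.
    by rewrite /c /= modnn /= bE -last_nth setUC.
  - move=> B /imsetP[i _ /pedge_inj ->]; exact: cE.
have [a [b [ab abG ab_tree]]] : exists a b, [/\ a != b, [set a; b] \in hedges G & ~~ tree [set a; b]].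
  case: (boolP [exists A in hedges G, ~~ tree A]) => [/existsP[A /andP[AG Atree]]|].
    have : #|A| == 2 by rewrite (G_unif AG).
    case/cards2P => a [b [ab eA]]; rewrite eA in AG Atree.
    by exists a, b.
  rewrite negb_exists => /forallP all_tree.
  have {}all_tree A : A \in hedges G -> tree A.
    by move=> AG; have := all_tree A; rewrite AG negbK.
  (* If all edges were tree edges, a vertex of largest rank on the cycle would have its parent as
     both of its neighbours there. *)
  have [l [c [l2 c_inj cE _]]] := loose_cycle_graph G_unif C0E C0_cyc.
  pose i0 := Ordinal (ltnW (ltnW l2)).
  case: (@arg_maxnP _ i0 xpredT (fun i => r (c i))) => // i _ i_max.
  have nbr j : [set c i; c j] \in hedges G -> i != j -> p (c i) = c j.
    move=> /all_tree/existsP[u /andP[uv /eqP e]] ij.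
    have : u \in [set c i; c j] by rewrite e set21.
    rewrite !inE => /orP[]/eqP uE.
      have : p u \in [set c i; c j] by rewrite e set22.
      rewrite !inE -uE (negbTE (pu _ uv)) /= => /eqP <-; by [].
    have : p u \in [set c i; c j] by rewrite e set22.
    rewrite !inE -uE (negbTE (pu _ uv)) orbF => /eqP pui.
    have [_ lt _] := pr u uv; have := i_max j isT.
    by rewrite -uE -pui /= leqNgt lt.
  have l1 := ltnW l2.
  have e1 := nbr _ (cE i); have e2 := cE (ord_pred i).
  rewrite ord_predK setUC in e2.
  have n1 : i != ordS i by rewrite eq_sym ordS_neq.
  have n2 : i != ord_pred i by rewrite -{1}(ord_predK i) ordS_neq.
  have /c_inj e : c (ordS i) = c (ord_pred i) by rewrite -(e1 n1) (nbr _ e2 n2).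
  have := ordSS_neq i l2.
  by rewrite e ord_predK eqxx.
have uniq_ab A : A \in hedges G -> ~~ tree A -> A = [set a; b].
  move=> AG Atree; have [C [CE C_cyc _ C_all]] := fundamental _ AG Atree.
  (* Both fundamental cycles equal the unique loose cycle, so the one of [A] passes through ab,
     which is not a tree edge. *)
  have [C' [C'E C'_cyc C'_ab _]] := fundamental _ abG ab_tree.
  have e : pedge m [set a; b] \in C.
    by rewrite -(C0_uniq C (conj CE C_cyc)) (C0_uniq C' (conj C'E C'_cyc)).
  by case: (C_all _ e) => [//|]; rewrite (negbTE ab_tree).
have not_v x y : [set x; y] \in hedges G -> ~~ tree [set x; y] -> x != y -> x != v.
  move=> xyG xy_tree xy; apply: contra xy_tree => /eqP xv.
  rewrite xv in xyG xy *; rewrite eq_sym in xy; have [_ _] := pr y xy.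
  have -> : hadj y v.
    by rewrite /hadj /= xy; apply/existsP; exists [set v; y]; rewrite xyG set21 set22.
  by move=> /(_ isT) py; apply/existsP; exists y; rewrite xy py setUC eqxx.
have av := not_v _ _ abG ab_tree ab.
have bv : b != v by apply: (not_v b a); rewrite 1?setUC// eq_sym.
have inj2 u u' : u != v -> u' != v -> [set u; p u] = [set u'; p u'] -> u = u'.
  move=> uv u'v e; apply/eqP/contraT => uu'.
  have : u \in [set u'; p u'] by rewrite -e set21.
  have : u' \in [set u; p u] by rewrite e set21.
  rewrite !inE eq_sym !(negbTE uu') /= => /eqP pu' /eqP pu''.
  have [_ lt _] := pr _ uv; have [_ lt' _] := pr _ u'v.
  by rewrite -pu' -pu'' in lt lt'; have := ltn_trans lt lt'; rewrite ltnn.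
exists p, a, b; split.
  split=> // u u'; rewrite /uedge.
  have [->|uv] := eqVneq u v; have [->|u'v] := eqVneq u' v => //.
  - by move=> e; case/negP: ab_tree; rewrite e; exact: Tp.
  - by move=> e; case/negP: ab_tree; rewrite -e; exact: Tp.
  - exact: inj2.
apply/setP => A; apply/idP/imsetP => [AG|[u _ ->]].
  case: (boolP (tree A)) => [/existsP[u /andP[uv /eqP ->]]|/(uniq_ab _ AG) ->].
    by exists u; rewrite // /uedge (negbTE uv).
  by exists v; rewrite // /uedge eqxx.
by rewrite /uedge; case: eqP => [_|/eqP /pE].
Qed.

End Structure.

(** * Isomorphisms *)

Lemma hiso_connected (H1 H2 : hypergraph) : hiso H1 H2 -> hconnected H1 -> hconnected H2.
Proof.
case=> f f_bij HE H1_conn; have [g fK gK] := f_bij.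
have up x y : connect (@hadj H1) x y -> connect (@hadj H2) (f x) (f y).
  case/connectP => s; elim: s x => [|z s IHs] x /=; first by move=> _ ->.
  case/andP => xz zs /(IHs _ zs); apply: connect_trans; apply: connect1.
  by rewrite (hadj_iso _ _ (bij_inj f_bij) HE).
by move=> x y; rewrite -(gK x) -(gK y); exact/up/H1_conn.
Qed.

Lemma hiso_uniform m (H1 H2 : hypergraph) : hiso H1 H2 -> huniform m H1 -> huniform m H2.
Proof.
case=> f f_bij HE H1_unif e; rewrite HE => /imsetP[e' e'H ->].
by rewrite card_imset ?H1_unif//; exact: bij_inj.
Qed.

Lemma hiso_linear (H1 H2 : hypergraph) : hiso H1 H2 -> hlinear H1 -> hlinear H2.
Proof.
case=> f f_bij HE H1_lin e1 e2; rewrite HE => /imsetP[e1' e1H ->] /imsetP[e2' e2H ->] ne.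
have f_inj := bij_inj f_bij.
rewrite -imsetI; last by move=> ? ? _ _; exact: f_inj.
by rewrite card_imset//; apply: H1_lin => //; apply: contraNneq ne => ->.
Qed.

Lemma hiso_card_hedges (H1 H2 : hypergraph) : hiso H1 H2 -> #|hedges H2| = #|hedges H1|.
Proof.
by case=> f f_bij ->; apply: card_imset; exact/imset_inj/bij_inj.
Qed.

Lemma loose_cycle_imset (V1 V2 : finType) (f : V1 -> V2) (C : {set {set V1}}) :
  injective f -> is_loose_cycle C -> is_loose_cycle [set f @: (e : {set V1}) | e in C].
Proof.
move=> f_inj [l [v [e [l2 v_inj eI e_disj ->]]]].
have fI (A B : {set V1}) : f @: A :&: f @: B = f @: (A :&: B).
  by rewrite imsetI// => ? ? _ _; exact: f_inj.
exists l, (f \o v), (fun i => f @: e i); split=> //.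
- exact: inj_comp.
- by move=> i; rewrite fI eI imset_set1.
- move=> i j ji jSi iSj; have := e_disj i j ji jSi iSj.
  by rewrite -!setI_eq0 fI => /eqP ->; rewrite imset0.
- by rewrite -imset_comp.
Qed.

Lemma hiso_unicyclic (H1 H2 : hypergraph) : hiso H1 H2 -> unicyclic H1 -> unicyclic H2.
Proof.
move=> iso [H1_lin [C [[CE C_cyc] C_uniq]]]; split; first exact: hiso_linear H1_lin.
case: iso => f [g fK gK] HE.
have f_inj := can_inj fK; have g_inj := can_inj gK.
have gf (e : {set H1}) : g @: (f @: e) = e.
  by rewrite -imset_comp (eq_imset _ (fK : g \o f =1 id)) imset_id.
have fg (e : {set H2}) : f @: (g @: e) = e.
  by rewrite -imset_comp (eq_imset _ (gK : f \o g =1 id)) imset_id.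
exists [set f @: (e : {set H1}) | e in C]; split.
  by split; [rewrite HE imsetS|exact: loose_cycle_imset].
move=> C' [C'E C'_cyc].
have -> : C = [set g @: (e : {set H2}) | e in C'].
  apply: C_uniq; split; last exact: loose_cycle_imset.
  apply/subsetP => _ /imsetP[e eC' ->]; have := subsetP C'E _ eC'.
  by rewrite HE => /imsetP[e' e'H ->]; rewrite gf.
rewrite -imset_comp -[RHS]imset_id; apply: eq_imset => e /=; exact: fg.
Qed.

(* phi embeds the vertices of the graph as the core of H, and every other
   vertex of H lies in exactly one edge. *)
Section PowerCore.
Variables (m : nat) (G H : hypergraph) (I : finType).
Variables (gE : I -> {set G}) (hE : I -> {set H}) (phi : G -> H).
Hypotheses (m_gt1 : 1 < m) (G_unif : huniform 2 G) (hE_card : forall i, #|hE i| = m).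
Hypotheses (GE : hedges G = [set gE i | i : I]) (HE : hedges H = [set hE i | i : I]).
Hypotheses (gE_inj : injective gE) (phi_inj : injective phi).
Hypothesis phi_in : forall x i, (phi x \in hE i) = (x \in gE i).
Hypothesis phi_out : forall y, y \notin codom phi -> exists i, forall i', (y \in hE i') = (i' == i).

Lemma power_core_hiso : hiso (power_hypergraph m G) H.
Proof.
have idxP (e : {e : {set G} | e \in hedges G}) : exists i, gE i = val e.
  have : val e \in [set gE i | i : I] by rewrite -GE; exact: valP.
  by case/imsetP => i _ ->; exists i.
have [idx idxE] := fin_all_exists idxP.
(* The [m - 2] vertices of an edge off the core; any numbering of them will do, as they lie in no
   other edge. *)
pose B (e : {e : {set G} | e \in hedges G}) := hE (idx e) :\: phi @: val e.
have B_card e : #|B e| = m - 2.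
  rewrite cardsD hE_card; congr (_ - _).
  have -> : hE (idx e) :&: phi @: val e = phi @: val e.
    by apply/setIidPr/subsetP => _ /imsetP[x xe ->]; rewrite phi_in idxE.
  by rewrite card_imset// (G_unif (valP e)).
have B_out e y : y \in B e -> y \notin codom phi.
  case/setDP => ye /negP y_phi; apply/negP => /codomP[x yx]; apply: y_phi.
  by rewrite yx imset_f// -idxE -phi_in -yx.
pose f (z : power_hypergraph m G) : H := match z with
  | inl x => phi x
  | inr q => enum_val (cast_ord (esym (B_card q.1)) q.2) end.
have f_inr q : f (inr q) \in B q.1 by exact: enum_valP.
have f_inj : injective f.
  have lr x q : f (inl x) <> f (inr q).
    by move=> e; have /negP := B_out _ _ (f_inr q); rewrite -e; apply; exact: codom_f.
  move=> [x|q] [y|q'] e; [by rewrite (phi_inj e)|by case: (lr x q')|by case: (lr y q)|].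
  have [i iE] := phi_out (B_out _ _ (f_inr q)).
  have /setDP[q_in _] := f_inr q; have /setDP[] := f_inr q'.
  rewrite -e iE => /eqP q'i _; move: q_in; rewrite iE => /eqP qi.
  case: q q' e q'i qi {iE} => [e1 j1] [e2 j2] /= e e2i e1i.
  have e12 : e1 = e2 by apply: val_inj; rewrite -!idxE e1i e2i.
  by rewrite -{}e12 in j2 e e2i *; have /cast_ord_inj -> := enum_val_inj e.
have f_surj y : exists z, f z = y.
  case: (boolP (y \in codom phi)) => [/codomP[x ->]|y_out]; first by exists (inl x).
  have [i iE] := phi_out y_out.
  have eG : gE i \in hedges G by rewrite GE imset_f.
  pose e : {e : {set G} | e \in hedges G} := exist _ (gE i) eG.
  have idx_e : idx e = i by apply: gE_inj; rewrite idxE.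
  have yB : y \in B e.
    rewrite inE idx_e iE eqxx andbT; apply: contra y_out => /imsetP[x _ ->].
    exact: codom_f.
  exists (inr (e, cast_ord (B_card e) (enum_rank_in yB y))).
  by rewrite /f /= cast_ordK enum_rankK_in.
have [g fg] := fin_all_exists f_surj.
exists f; first by exists g => // z; apply: f_inj; rewrite fg.
rewrite HE hedges_power GE -!imset_comp; apply: eq_imset => i /=.
apply/esym/eqP; rewrite eqEcard card_imset// hE_card (power_uniform G_unif m_gt1); last first.
  by rewrite hedges_power imset_f// GE imset_f.
rewrite leqnn andbT; apply/subsetP => _ /imsetP[[x|[e j]] zi ->].
  by rewrite /f phi_in; rewrite inE in zi.
have := f_inr (e, j); rewrite inE => /andP[_]; congr (_ \in hE _).
by apply: gE_inj; rewrite idxE; move: zi; rewrite inE => /eqP.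
Qed.

End PowerCore.

Lemma hiso_power m (G1 G2 : hypergraph) : 1 < m -> huniform 2 G1 -> hiso G1 G2 ->
  hiso (power_hypergraph m G1) (power_hypergraph m G2).
Proof.
move=> m_gt1 G1_unif iso; have G2_unif := hiso_uniform iso G1_unif.
case: iso => f f_bij GE; have [g fK gK] := f_bij; have f_inj := bij_inj f_bij.
pose I : finType := {e : {set G1} | e \in hedges G1}.
have fe (e : I) : f @: val e \in hedges G2 by rewrite GE imset_f//; exact: valP.
apply: (@power_core_hiso m G1 (power_hypergraph m G2) I val
  (fun e => pedge m (f @: val e)) (fun x => inl (f x))) => //.
- by move=> e; apply: (power_uniform G2_unif m_gt1); rewrite hedges_power imset_f.
- apply/setP => e; apply/idP/imsetP => [eG|[e' _ ->]]; last exact: valP.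
  by exists (exist _ e eG).
- rewrite hedges_power GE -imset_comp; apply/setP => e.
  apply/imsetP/imsetP => [[e' e'G ->]|[e' _ ->]]; first by exists (exist _ e' e'G).
  by exists (val e') => //; exact: valP.
- exact: val_inj.
- by move=> x y [/f_inj].
- by move=> x e; rewrite inE mem_imset.
case=> [y|q] y_out; first by case/negP: y_out; apply/codomP; exists (g y); rewrite gK.
have : val q.1 \in [set f @: (e : {set G1}) | e in hedges G1] by rewrite -GE; exact: valP.
case/imsetP => e eG qE.
exists (exist _ e eG) => e'; rewrite inE qE (inj_eq (imset_inj f_inj)).
by rewrite -(inj_eq val_inj) eq_sym.
Qed.

Lemma hiso_id_edges (G1 : hypergraph) (E : {set {set G1}}) (E0 : set0 \notin E) :
  hedges G1 = E -> hiso G1 (Hypergraph E0).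
Proof.
move=> GE; exists id; first by exists id.
by rewrite /= GE -[LHS]imset_id; apply: eq_imset => e; rewrite imset_id.
Qed.

Lemma ugraph_hiso (V V' : finType) (v : V) p a b (v' : V') p' a' b'
    (uni : unistruct v p a b) (uni' : unistruct v' p' a' b') (h : V -> V') :
  bijective h -> h v = v' -> [set h a; h b] = [set a'; b'] ->
  (forall u, u != v -> h (p u) = p' (h u)) -> hiso (ugraph uni) (ugraph uni').
Proof.
move=> h_bij hv hab hp; exists h => //=; have [g hK gK] := h_bij.
have hE u : h @: uedge v p a b u = uedge v' p' a' b' (h u).
  rewrite /uedge -hv (inj_eq (bij_inj h_bij)).
  by case: eqP => [_|/eqP uv]; rewrite imsetU1 imset_set1 // hp.
apply/setP => e; apply/imsetP/imsetP => [[u' _ ->]|[_ /imsetP[u _ ->] ->]].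
  by exists (uedge v p a b (g u')); rewrite ?imset_f// hE gK.
by exists (h u).
Qed.

(** Vertices of a shape other than the named ones are interchangeable, so an isomorphism of shapes
    only has to match the named ones. *)
Lemma bijection_extend (V V' : finType) (s : seq V) (s' : seq V') :
  #|V| = #|V'| -> uniq s -> uniq s' -> size s = size s' ->
  exists2 h : V -> V', bijective h & map h s = s'.
Proof.
move=> cVV' us us' ss'.
pose full (W : finType) (t : seq W) := t ++ filter [predC t] (enum W).
have full_mem (W : finType) (t : seq W) x : x \in full W t.
  by rewrite mem_cat mem_filter mem_enum /= andbT orbN.
have full_uniq (W : finType) (t : seq W) : uniq t -> uniq (full W t).
  move=> ut; rewrite cat_uniq ut filter_uniq ?enum_uniq// andbT /=.
  by apply/hasPn => x; rewrite mem_filter => /andP[].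
have full_size (W : finType) (t : seq W) : uniq t -> size (full W t) = #|W|.
  move=> /full_uniq/card_uniqP <-; apply: eq_card => x; by rewrite full_mem.
(* The default element for [nth] exists only if [V'] is nonempty. *)
case: (pickP (mem V')) => [x' _|V'0]; last first.
  have V0 (x : V) : False.
    have : #|V| = 0 by rewrite cVV'; apply: eq_card0 => y; exact: V'0.
    by move/card0_eq/(_ x).
  case: s us ss' => [|x]; last by case: (V0 x).
  case: s' us' => // _ _ _; exists (fun x => match V0 x with end) => //.
  have V'0' (x : V') : False by have := V'0 x.
  by exists (fun x => match V'0' x with end) => x; [case: (V0 x)|case: (V'0' x)].
pose h x := nth x' (full V' s') (index x (full V s)).
have lt x : index x (full V s) < size (full V' s').
  by rewrite full_size// -cVV' -(full_size _ s)// index_mem.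
have h_inj : injective h.
  move=> x y /eqP; rewrite nth_uniq ?full_uniq// => /eqP e.
  by rewrite -(nth_index x (full_mem _ s x)) e nth_index.
exists h; first by apply: inj_card_bij; rewrite // cVV'.
apply: (@eq_from_nth _ x'); rewrite size_map// => i i_lt.
case: s us ss' i_lt @h lt h_inj => // x s us ss' i_lt h lt h_inj.
rewrite (nth_map x)// /h /full index_cat mem_nth// index_uniq//.
by rewrite nth_cat -ss' i_lt.
Qed.

(** The cycle is the triangle v a b. A vertex of a cycle has two distinct neighbours on it; this
    excludes w, whose only neighbour is z, and then every other vertex outside the triangle, which
    is left with v alone. *)
Lemma shape_unicyclic m (V : finType) (v w z a b : V)
    (uni : unistruct v (shape_parent v w z) a b) :
  w != v -> a != w -> b != w ->
  exists! C : {set {set power_hypergraph m (ugraph uni)}},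
    C \subset hedges (power_hypergraph m (ugraph uni)) /\ is_loose_cycle C.
Proof.
move=> wv aw bw; have [ab av bv pu _] := uni.
have G_unif := ugraph_uniform uni.
pose G := ugraph uni.
have va : [set v; a] \in hedges G.
  apply/imsetP; exists a => //; rewrite /uedge (negbTE av) /shape_parent (negbTE aw).
  by rewrite setUC.
have bv_in : [set b; v] \in hedges G.
  by apply/imsetP; exists b => //; rewrite /uedge (negbTE bv) /shape_parent (negbTE bw).
have ab_in : [set a; b] \in hedges G by apply/imsetP; exists v; rewrite // /uedge eqxx.
pose tri := [set [set v; a]; [set a; b]; [set b; v]].
have tri_in : tri \subset hedges G.
  by apply/subsetP => A; rewrite !inE => /orP[/orP[]|] /eqP ->.
pose C0 := [set pedge m (A : {set G}) | A in tri].
have C0E : C0 \subset hedges (power_hypergraph m G) by rewrite hedges_power imsetS.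
exists C0; split.
  split=> //; pose t := [tuple v; a; b].
  have t_inj : injective (tnth t).
    move=> i j /eqP; rewrite (tnth_nth v) [X in _ == X](tnth_nth v) nth_uniq ?size_tuple//.
      by move/eqP/val_inj.
    by rewrite /= !inE negb_or !(eq_sym v) av bv ab.
  have := @graph_cycle_loose m G 3 (tnth t) isT t_inj.
  suff -> : [set pedge m ([set tnth t i; tnth t (ordS i)] : {set G}) | i : 'I_3] = C0 by [].
  rewrite /C0; apply/setP => A; apply/imsetP/imsetP => [[i _ ->]|[B]].
    exists [set tnth t i; tnth t (ordS i)] => //.
    by rewrite !inE; case: i => [[|[|[|//]]] lt]; rewrite !(tnth_nth v) /= ?eqxx ?orbT.
  rewrite !inE -orbA => /or3P[]/eqP -> ->.
  - by exists ord0; rewrite // !(tnth_nth v).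
  - by exists (@Ordinal 3 1 isT); rewrite // !(tnth_nth v).
  - by exists (@Ordinal 3 2 isT); rewrite // !(tnth_nth v).
move=> C [CE C_cyc].
have [l [c [l2 c_inj cE ->]]] := loose_cycle_graph G_unif CE C_cyc.
have l1 := ltnW l2.
have nbrE x y : [set x; y] \in hedges G -> x != v -> x != y ->
    [|| y == shape_parent v w z x, (y == w) && (x == z) | (x \in [set a; b]) && (y \in [set a; b])].
  case/imsetP => u _; rewrite /uedge; case: eqP => [_ e|/eqP uv e] xv xy.
    by rewrite -e !inE !eqxx orbT !orbT.
  have xu : x \in [set u; shape_parent v w z u] by rewrite -e set21.
  have yu : y \in [set u; shape_parent v w z u] by rewrite -e set22.
  move: xu yu; rewrite !inE => /orP[/eqP xu|/eqP xu] /orP[]/eqP yu.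
  - by rewrite xu yu eqxx in xy.
  - by rewrite yu xu eqxx.
  - move: xu yu; rewrite /shape_parent; case: (eqVneq u w) => [-> -> ->|_ xv' _].
      by rewrite !eqxx orbT.
    by rewrite xv' eqxx in xv.
  - by rewrite xu yu eqxx in xy.
have unique_nbr x y : (forall y', [set x; y'] \in hedges G -> x != y' -> y' \in codom c -> y' = y) ->
    x \notin codom c.
  move=> x_nbr; apply/negP => /codomP[i xi].
  have n1 : i != ordS i by rewrite eq_sym ordS_neq.
  have n2 : i != ord_pred i by rewrite -{1}(ord_predK i) ordS_neq.
  have e1 : c (ordS i) = y.
    by apply: x_nbr; rewrite ?xi ?cE ?(inj_eq c_inj) ?codom_f.
  have e2 : c (ord_pred i) = y.
    apply: x_nbr; rewrite ?xi ?(inj_eq c_inj) ?codom_f//.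
    by have := cE (ord_pred i); rewrite ord_predK setUC.
  have /c_inj e : c (ordS i) = c (ord_pred i) by rewrite e1 e2.
  by have := ordSS_neq i l2; rewrite e ord_predK eqxx.
have zw : z != w by have := pu _ wv; rewrite /shape_parent eqxx.
have w_out : w \notin codom c.
  apply: (unique_nbr w z) => y /nbrE H wy _; have := H wv wy; rewrite /shape_parent eqxx.
  by rewrite !inE !(eq_sym w) (negbTE zw) (negbTE aw) (negbTE bw) andbF !orbF => /eqP.
have c_tri i : c i \in [set v; a; b].
  apply/contraT; rewrite !inE !negb_or -andbA => /and3P[cv ca cb].
  have := unique_nbr (c i) v; rewrite codom_f; apply=> y /nbrE H cy y_in; have := H cv cy.
  rewrite !inE (negbTE ca) (negbTE cb) !orbF /shape_parent.
  have [ciw|_] := eqVneq (c i) w; first by case/negP: w_out; rewrite -[X in X \in _]ciw codom_f.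
  case/orP => [/eqP //|/andP[/eqP yw _]].
  by rewrite yw in y_in; rewrite y_in in w_out.
(* The edges of the cycle are among the three of the triangle and number [l >= 3]. *)
apply/esym/eqP; rewrite eqEcard; apply/andP; split.
  apply/subsetP => _ /imsetP[i _ ->]; apply: imset_f.
  have n1 : c i != c (ordS i) by rewrite (inj_eq c_inj) eq_sym ordS_neq.
  move: n1 (c_tri i) (c_tri (ordS i)); move: (c i) (c (ordS i)) => x y xy.
  rewrite !inE -!orbA => /or3P[]/eqP xE /or3P[]/eqP yE; rewrite xE yE ?eqxx// in xy *;
    by rewrite ?eqxx ?orbT // setUC ?eqxx ?orbT.
rewrite card_imset; last exact: pedge_inj.
apply: (@leq_trans 3).
  rewrite /tri (leq_trans (leq_card_setU _ _))// cards1 addn1 ltnS.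
  by rewrite (leq_trans (leq_card_setU _ _))// !cards1.
rewrite card_imset ?card_ord// => i j /pedge_inj e.
have : c i \in [set c j; c (ordS j)] by rewrite -e set21.
rewrite !inE !(inj_eq c_inj) => /orP[/eqP//|/eqP ij].
have : c (ordS i) \in [set c j; c (ordS j)] by rewrite -e set22.
rewrite !inE !(inj_eq c_inj) ij (negbTE (ordSS_neq _ l2)) (negbTE (ordS_neq _ l1)).
by [].
Qed.

(** * Cores of the named hypergraphs *)

(** Collects the hypotheses of [power_core_hiso] for a tree plus ab, with the edges indexed by the
    vertices. In this form they pass directly through [attach]. *)
Definition power_core m (H : hypergraph) (V : finType) (v : V) (p : V -> V) (a b : V)
    (phi : V -> H) (hE : V -> {set H}) : Prop :=
  [/\ unistruct v p a b, hedges H = [set hE u | u : V] /\ (forall u, #|hE u| = m), injective phi,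
      forall x u, (phi x \in hE u) = (x \in uedge v p a b u)
    & forall y, y \notin codom phi -> exists u, forall u', (y \in hE u') = (u' == u)].

Lemma power_coreP m (H : hypergraph) (V : finType) (v : V) p a b (phi : V -> H) hE
    (uni : unistruct v p a b) :
  1 < m -> power_core m v p a b phi hE -> hiso (power_hypergraph m (ugraph uni)) H.
Proof.
move=> m_gt1 [_ [HE hE_card] phi_inj phi_in phi_out]; have [_ _ _ _ u_inj] := uni.
exact: (@power_core_hiso m (ugraph uni) H V (uedge v p a b) hE phi m_gt1 (ugraph_uniform uni)).
Qed.

Section CycleCore.
Variable m : nat.
Hypothesis m_gt1 : 1 < m.
Local Notation H := (loose_cycle m 3).
Let i1 : 'I_3 := @Ordinal 3 1 isT.
Let i2 : 'I_3 := @Ordinal 3 2 isT.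

(* cycle_edge i joins the core vertices i and i + 1, whereas here 1 and 2 index
   their edges to 0, and 0 indexes the edge between them. *)
Definition triangle_index (u : 'I_3) : 'I_3 :=
  if u == ord0 then i1 else if u == i1 then ord0 else i2.

Lemma loose_cycle_core :
  power_core m (H := H) ord0 (fun=> ord0) i1 i2 (fun i => inl i)
    (fun u => cycle_edge m (triangle_index u)).
Proof.
have in_cycle x i : (inl x \in cycle_edge m (l := 3) i) = (x == i) || (x == ordS i).
  rewrite !inE !(inj_eq (@inl_inj _ _)); apply/orP/idP => [[//|/imsetP[]//]|]; by left.
have inr_cycle q i : (inr q \in cycle_edge m (l := 3) i) = (q.1 == i).
  rewrite !inE /=; apply/imsetP/eqP => [[j _ [->]]//|<-].
  by exists q.2; case: q.
have idx_inj : injective triangle_index.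
  by move=> [[|[|[|//]]] lt] [[|[|[|//]]] lt'] // e; apply: val_inj.
split.
- split=> //; first by move=> [[|[|[|//]]] lt].
  move=> u u' /setP e; have := e u; have := e u'; clear e.
  rewrite /uedge; case: u u' => [[|[|[|//]]] lt] [[|[|[|//]]] lt'];
  by rewrite !inE /= => // *; apply: val_inj.
- split.
    apply/setP => A; apply/imsetP/imsetP => -[i _ ->].
      by exists (finv triangle_index i) => //=; rewrite (f_finv idx_inj).
    by exists (triangle_index i).
  move=> u; rewrite /cycle_edge cardsU; set D := _ :&: _.
  have -> : D = set0.
    apply/setP => z; rewrite !inE; apply/negbTE/andP => -[+ /imsetP[j _ zE]].
    by rewrite zE.
  rewrite cards0 subn0 cards2 card_imset ?card_ord; last by move=> ? ? [].
  by rewrite (inj_eq (@inl_inj _ _)) eq_sym ordS_neq// subnKC.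
- exact: inl_inj.
- move=> x u; rewrite in_cycle /uedge /triangle_index.
  by case: x u => [[|[|[|//]]] lt] [[|[|[|//]]] lt'] /=; rewrite !inE.
case=> [x|q] y_out; first by rewrite codom_f in y_out.
exists (finv triangle_index q.1) => u; rewrite inr_cycle.
by rewrite -[RHS](inj_eq idx_inj) (f_finv idx_inj) eq_sym.
Qed.

End CycleCore.

Section AttachCore.
Variables (m : nat) (H : hypergraph) (V : finType) (v : V) (p : V -> V) (a b : V).
Variables (phi : V -> H) (hE : V -> {set H}) (c : H -> nat).
Hypotheses (m_gt1 : 1 < m) (core : power_core m v p a b phi hE).
Local Notation pend := {x : H & 'I_(c x)}.
Variable par : pend -> V.
Hypothesis par_tag : forall q, phi (par q) = tag q.

Definition attach_parent (u : V + pend) : V + pend :=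
  match u with inl u => inl (p u) | inr q => inl (par q) end.

(** Of the [m - 1] new vertices of a pendant edge, number 0 stands for the new graph vertex; the
    other [m - 2] are those added by the power. *)
Definition attach_phi (u : V + pend) : attach m c :=
  match u with
  | inl u => inl (phi u)
  | inr q => inr (q, Ordinal (eqbRL (subn_gt0 1 m) m_gt1))
  end.

Definition attach_edge (u : V + pend) : {set attach m c} :=
  match u with inl u => old_edge m c (hE u) | inr q => new_edge m q end.

Lemma attach_core :
  power_core m (inl v) attach_parent (inl a) (inl b) attach_phi attach_edge.
Proof.
have [uni [HE hE_card] phi_inj phi_in phi_out] := core.
have [ab av bv pu u_inj] := uni.
have uedgel u : uedge (inl v) attach_parent (inl a) (inl b) (inl u) =
    [set inl x | x in uedge v p a b u] :> {set V + pend}.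
  by rewrite /uedge (inj_eq (@inl_inj _ _)); case: eqP => _; rewrite imsetU1 imset_set1.
have uedger q : uedge (inl v) attach_parent (inl a) (inl b) (inr q) =
    [set inr q; inl (par q)] :> {set V + pend} by [].
have in_old (h : H) u : (inl h \in old_edge m c (hE u)) = (h \in hE u).
  by rewrite mem_imset//; exact: inl_inj.
have inr_old q u : (inr q \in old_edge m c (hE u)) = false.
  by apply/imsetP => -[].
have in_new (h : H) q : (inl h \in new_edge m (c:=c) q) = (h == tag q).
  rewrite !inE (inj_eq (@inl_inj _ _)); apply/orP/idP => [[//|/imsetP[]//]|]; by left.
have inr_new q q' : (inr q \in new_edge m (c:=c) q') = (q.1 == q').
  rewrite !inE /=; apply/imsetP/eqP => [[j _ [->]]//|<-].
  by exists q.2; case: q.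
have phi_inj' : injective attach_phi by move=> [x|q] [y|q'] //= [] => [/phi_inj ->|->].
split=> //.
- split=> [|||[u|q]|].
  + by rewrite (inj_eq (@inl_inj _ _)).
  + by rewrite (inj_eq (@inl_inj _ _)).
  + by rewrite (inj_eq (@inl_inj _ _)).
  + by rewrite !(inj_eq (@inl_inj _ _)); exact: pu.
  + by [].
  move=> [u|q] [u'|q'].
  + by rewrite !uedgel => /(imset_inj (@inl_inj _ _))/u_inj ->.
  + rewrite uedgel uedger => /setP/(_ (inr q')); rewrite !inE eqxx.
    by case: imsetP => [[]|].
  + rewrite uedgel uedger => /setP/(_ (inr q)); rewrite !inE eqxx.
    by case: imsetP => [[]|].
  + by rewrite !uedger => /setP/(_ (inr q)); rewrite !inE eqxx /= orbF => /esym/eqP.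
- split.
    rewrite /= HE -imset_comp; apply/setP => A; rewrite inE; apply/orP/imsetP.
      by case=> /imsetP[u _ ->]; [exists (inl u)|exists (inr u)].
    by case=> -[u|q] _ ->; [left|right]; exact: imset_f.
  case=> [u|q] /=; first by rewrite card_imset ?hE_card//; exact: inl_inj.
  rewrite /new_edge cardsU1 card_imset ?card_ord; last by move=> ? ? [].
  have -> : inl (tag q) \notin [set inr (q, j) | j : 'I_(m - 1)] by apply/imsetP => -[].
  by rewrite /= subnKC// ltnW.
- move=> [x|q] [u|q'].
  + by rewrite uedgel in_old phi_in mem_imset//; exact: inl_inj.
  + by rewrite uedger in_new -par_tag !inE (inj_eq phi_inj).
  + by rewrite uedgel inr_old; apply/esym/negbTE/imsetP => -[].
  + by rewrite uedger inr_new !inE orbF.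
case=> [h|q] y_out.
  have h_out : h \notin codom phi.
    by apply: contra y_out => /codomP[x ->]; exact: (codom_f attach_phi (inl x)).
  have [u uE] := phi_out _ h_out; exists (inl u) => -[u'|q'] /=.
    by rewrite in_old uE.
  rewrite in_new; apply/negbTE; apply: contra h_out => /eqP ->.
  by rewrite -par_tag codom_f.
by exists (inr q.1) => -[u'|q'] /=; rewrite ?inr_old// inr_new eq_sym.
Qed.

End AttachCore.

Lemma unistruct_ext (V : finType) (v : V) p p' a b :
  (forall u, u != v -> p u = p' u) -> unistruct v p a b ->
  unistruct v p' a b /\ uedge v p a b =1 uedge v p' a b.
Proof.
move=> pp' [ab av bv pu inj].
have E : uedge v p a b =1 uedge v p' a b.
  by move=> u; rewrite /uedge; case: eqP => // /eqP /pp' ->.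
by split=> //; split=> // [u uv|]; [rewrite -pp' ?pu|exact: eq_inj inj E].
Qed.

Lemma unistruct_swap (V : finType) (v : V) p a b :
  unistruct v p a b -> unistruct v p b a /\ uedge v p a b =1 uedge v p b a.
Proof.
move=> [ab av bv pu inj].
have E : uedge v p a b =1 uedge v p b a by move=> u; rewrite /uedge setUC.
by split=> //; split=> //; [rewrite eq_sym|exact: eq_inj inj E].
Qed.

Lemma exists_notin (T : finType) (s : seq T) : size s < #|T| -> exists x, x \notin s.
Proof.
move=> s_lt; case: (pickP [pred x | x \notin s]) => [x xs|all_s]; first by exists x.
move: s_lt; rewrite ltnNge -(eq_card (_ : mem s =i predT)) ?card_size// => x.
by have := all_s x; rewrite /= inE => /negbFE ->.
Qed.

Lemma card_tagged_sum (T : finType) (c : T -> nat) : #|{: {x : T & 'I_(c x)}}| = \sum_x c x.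
Proof.
rewrite card_tagged sumnE big_map big_enum /=.
by apply: eq_bigr => x _; rewrite card_ord.
Qed.

(** * Graph models of the three named hypergraphs *)

Section UCModel.
Variables (m : nat) (s : seq nat).
Hypothesis m_gt1 : 1 < m.

Definition uc_count (x : loose_cycle m 3) : nat := if x is inl i then nth 0 s i else 0.
Definition uc_par (q : {x : loose_cycle m 3 & 'I_(uc_count x)}) : 'I_3 :=
  if tag q is inl i then i else ord0.

Lemma uc_par_tag q : inl (uc_par q) = tag q.
Proof. by case: q => [[i|x] [j lt]]. Qed.

Definition uc_vert : finType := ('I_3 + {x : loose_cycle m 3 & 'I_(uc_count x)})%type.

Definition uc_phi : uc_vert -> UC m 3 s :=
  attach_phi (fun i => inl i : loose_cycle m 3) m_gt1 (c := uc_count).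

Definition uc_edge : uc_vert -> {set UC m 3 s} :=
  attach_edge m (fun u => cycle_edge m (triangle_index u) : {set loose_cycle m 3}) (c := uc_count).

Lemma uc_core : power_core m (H := UC m 3 s)
  (inl ord0) (attach_parent (fun=> ord0) uc_par)
  (inl (@Ordinal 3 1 isT)) (inl (@Ordinal 3 2 isT))
  uc_phi uc_edge.
Proof. exact: (attach_core m_gt1 (loose_cycle_core m_gt1) uc_par_tag). Qed.

Lemma card_uc_vert : #|uc_vert| = 3 + (nth 0 s 0 + nth 0 s 1 + nth 0 s 2).
Proof.
rewrite card_sum card_ord card_tagged_sum big_sumType /= [X in _ + (_ + X)]big1 // addn0.
by rewrite !big_ord_recl big_ord0 /= !addn0 !addnA.
Qed.

End UCModel.

Definition shape_model (H : hypergraph) (m k : nat) (V : finType) (v w z a b : V) : Prop :=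
  [/\ #|V| = k, uniq [:: v; a; b; w] &
    exists uni : unistruct v (shape_parent v w z) a b, hiso (power_hypergraph m (ugraph uni)) H].

Lemma core_model (H : hypergraph) (m k : nat) (V : finType) (v w z a b : V) p phi hE :
  1 < m -> power_core m (H := H) v p a b phi hE -> #|V| = k -> uniq [:: v; a; b; w] ->
  (forall u, u != v -> p u = shape_parent v w z u) -> shape_model H m k v w z a b.
Proof.
move=> m_gt1 core cV us pE; split=> //; have [uni _ _ _ _] := core.
have [uni' E] := unistruct_ext pE uni; exists uni'.
apply: hiso_trans (power_coreP uni m_gt1 core).
apply: hiso_power => //; first exact: (ugraph_uniform uni').
by apply: (@ugraph_hiso _ _ _ _ _ _ _ _ _ _ uni' uni id) => // [|u uv]; [exists id|rewrite pE].
Qed.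

Lemma UC1_model m k : 1 < m -> 8 <= k ->
  exists (V : finType) (v w a b : V), shape_model (UC m 3 [:: k - 3]) m k v w v a b.
Proof.
move=> m_gt1 k8; have cV : #|uc_vert m [:: k - 3]| = k.
  by rewrite card_uc_vert /= !addn0 subnKC// (leq_trans _ k8).
pose v : uc_vert m [:: k - 3] := inl ord0.
pose a : uc_vert m [:: k - 3] := inl (@Ordinal 3 1 isT).
pose b : uc_vert m [:: k - 3] := inl (@Ordinal 3 2 isT).
(* With [z = v] no pendant vertex is distinguished, so any vertex off the triangle can serve as
   w. *)
have [w w_out] : exists w, w \notin [:: v; a; b].
  by apply: exists_notin; rewrite /= cV (leq_trans _ k8).
exists _, v, w, a, b; apply: (core_model m_gt1 (uc_core _ m_gt1)) => //.
  by rewrite -[[:: v; a; b; w]]/([:: v; a; b] ++ [:: w]) cats1 rcons_uniq w_out.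
move=> [u|[[[[|[|[|//]]] lt]|x] [j lt']]] _; rewrite /shape_parent //=; case: ifP => // _;
  by congr inl; apply: val_inj.
Qed.

Lemma UC2_model m k : 1 < m -> 8 <= k ->
  exists (V : finType) (v w a b : V), shape_model (UC m 3 [:: k - 4; 1]) m k v w a a b.
Proof.
move=> m_gt1 k8; have cV : #|uc_vert m [:: k - 4; 1]| = k.
  by rewrite card_uc_vert /= addn0 addn1 addnS -addSn subnKC// (leq_trans _ k8).
pose v : uc_vert m [:: k - 4; 1] := inl ord0.
pose a : uc_vert m [:: k - 4; 1] := inl (@Ordinal 3 1 isT).
pose b : uc_vert m [:: k - 4; 1] := inl (@Ordinal 3 2 isT).
pose w : uc_vert m [:: k - 4; 1] :=
  inr (existT (fun x => 'I_(uc_count [:: k - 4; 1] x)) (inl (@Ordinal 3 1 isT)) ord0).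
exists _, v, w, a, b; apply: (core_model m_gt1 (uc_core _ m_gt1)) => //.
move=> [u|[[i|x] [j lt']]] _; rewrite /shape_parent //=.
have [i1|i1] := eqVneq i (@Ordinal 3 1 isT).
  move: lt'; rewrite i1 => lt'.
  have -> : Ordinal lt' = ord0 by apply: val_inj => /=; case: j lt'.
  by rewrite eqxx.
have -> : inr (existT (fun x => 'I_(uc_count [:: k - 4; 1] x)) (inl i) (Ordinal lt')) == w = false.
  by apply/negbTE; apply: contra i1 => /eqP[] ->.
case: i i1 lt' => [[|[|[|//]]] lt] // _ lt'.
by congr inl; apply: val_inj.
Qed.

Lemma U3C_model m k : 1 < m -> 8 <= k ->
  exists (V : finType) (v w z a b : V), shape_model (U3C m (k - 4)) m k v w z a b /\
    uniq [:: v; a; b; w; z].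
Proof.
move=> m_gt1 k8; set n := k - 4.
have n0 : 0 < n by rewrite subn_gt0 (leq_trans _ k8).
pose c3 : UC m 3 [:: n] -> nat := fun x => if x is inr (p, j)
  then ((tagged p == 0 :> nat) && (j == 0 :> nat) : nat) else 0.
pose p0 : {x : loose_cycle m 3 & 'I_(uc_count [:: n] x)} :=
  existT (fun x => 'I_(uc_count [:: n] x)) (inl ord0) (Ordinal n0).
pose j0 : 'I_(m - 1) := Ordinal (eqbRL (subn_gt0 1 m) m_gt1).
pose x0 : UC m 3 [:: n] := inr (p0, j0).
have p0P (p : {x : loose_cycle m 3 & 'I_(uc_count [:: n] x)}) : tagged p == 0 :> nat -> p = p0.
  case: p => [[i|x] [j lt']] //= /eqP j0'; subst j.
  have iE : i = ord0 by case: i lt' => [[|[|[|//]]] lt] // _; apply: val_inj.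
  by subst i; congr existT; apply: val_inj.
have c3P x : 0 < c3 x -> x = x0.
  case: x => [//|[p j]] /=; case: eqP => //= /eqP/p0P ->; case: eqP => //= jj _.
  by congr (inr (_, _)); apply: val_inj.
(* The further edge is attached at new vertex 0, the one chosen by [attach_phi], hence at a core
   vertex. The default [inl ord0] is never reached, since [c3] vanishes off [x0]. *)
pose par3 (q : {x : UC m 3 [:: n] & 'I_(c3 x)}) : uc_vert m [:: n] :=
  if tag q is inr (p, _) then inr p else inl ord0.
have par3_tag q : uc_phi m_gt1 (par3 q) = tag q.
  case: q => x j; have xE := c3P x (leq_ltn_trans (leq0n _) (ltn_ord j)); subst x.
  by rewrite /par3 /=.
have core := attach_core m_gt1 (uc_core [:: n] m_gt1) par3_tag.
pose V : finType := (uc_vert m [:: n] + {x : UC m 3 [:: n] & 'I_(c3 x)})%type.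
have cV : #|V| = k.
  rewrite card_sum card_uc_vert /= !addn0 card_tagged_sum (bigD1 x0)//= big1 => [|x xx0].
    by rewrite addn0 addnAC addnC subnK// (leq_trans _ k8).
  by apply/eqP; rewrite -leqn0 leqNgt; apply: contra xx0 => /c3P ->.
pose v : V := inl (inl ord0); pose a : V := inl (inl (@Ordinal 3 1 isT)).
pose b : V := inl (inl (@Ordinal 3 2 isT)).
pose w : V := inr (existT (fun x => 'I_(c3 x)) x0 ord0).
pose z : V := inl (inr p0).
exists V, v, w, z, a, b; split=> //.
apply: (core_model m_gt1 core) => //.
move=> [[u|[[[[|[|[|//]]] lt]|x] [j lt']]]|[x j]] _; rewrite /shape_parent //=.
  by congr (inl (inl _)); apply: val_inj.
have xE := c3P x (leq_ltn_trans (leq0n _) (ltn_ord j)); subst x.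
have -> : j = ord0 by apply: val_inj; case: j => [[|j] lt].
by rewrite eqxx.
Qed.

(** * The ordering *)

Section ShapeModels.
Variables (R : realType) (m k : nat).
Hypotheses (m_gt1 : 1 < m) (mk : 20 <= (k - 7) * (m - 1)).
Local Notation lam uni := (lambda1 R m (power_hypergraph m (ugraph uni))).

Lemma ugraph_edges_card (V : finType) (v : V) p a b (uni : unistruct v p a b) :
  #|hedges (power_hypergraph m (ugraph uni))| = #|V|.
Proof.
have [_ _ _ _ inj] := uni.
by rewrite hedges_power card_imset; [rewrite /= card_imset|exact: pedge_inj].
Qed.

Lemma power_gt0 (G : hypergraph) (x : G) : 0 < #|power_hypergraph m G|.
Proof. by apply/card_gt0P; exists (inl x). Qed.

Lemma shape_unicyclic_power H (V : finType) (v w z a b : V) :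
  shape_model H m k v w z a b -> unicyclic_power m k H.
Proof.
case=> cV; rewrite /= !inE !negb_or => /and4P[/and3P[va vb vw] /andP[ab aw] bw _] [uni iso].
have wv : w != v by rewrite eq_sym.
have G_unif := ugraph_uniform uni.
split.
- exact/(hiso_connected iso)/(graph_connected_power G_unif)/shape_connected.
- apply: (hiso_unicyclic iso); split; first exact: power_linear.
  exact: shape_unicyclic.
- exact/(hiso_uniform iso)/power_uniform.
- by rewrite (hiso_card_hedges iso) ugraph_edges_card.
- by exists (ugraph uni).
Qed.

Lemma shape_lambda H (V : finType) (v w z a b : V) (uni : unistruct v (shape_parent v w z) a b) :
  hiso (power_hypergraph m (ugraph uni)) H -> lambda1 R m H = lam uni.
Proof. by move=> iso; rewrite -(lambda1_hiso R m_gt1 _ iso)// (power_gt0 (G := ugraph uni) v). Qed.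

Lemma shape_transfer (V V' : finType) (v w z a b : V) (v' w' z' a' b' : V')
    (uni : unistruct v (shape_parent v w z) a b)
    (uni' : unistruct v' (shape_parent v' w' z') a' b') (h : V -> V') :
  bijective h -> h v = v' -> h w = w' -> h z = z' -> h a = a' -> h b = b' ->
  hiso (power_hypergraph m (ugraph uni)) (power_hypergraph m (ugraph uni')).
Proof.
move=> h_bij hv hw hz ha hb; apply: hiso_power => //; first exact: (ugraph_uniform uni).
apply: (ugraph_hiso _ _ h_bij) => //; first by rewrite ha hb.
move=> u uv; rewrite /shape_parent -hw (inj_eq (bij_inj h_bij)).
by case: ifP.
Qed.

Lemma shape_pair (V : finType) (v w z a b : V) :
  uniq [:: v; a; b; w] -> [|| z == v, z == a | z \notin [:: v; a; b; w]] ->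
  unistruct v (shape_parent v w z) a b.
Proof.
rewrite /= !inE !negb_or => /and4P[/and3P[va vb vw] /andP[ab aw] bw _] zP.
have zw : z != w.
  by case/or3P: zP => [/eqP ->|/eqP ->|/and4P[]].
apply: shape_uni => //; rewrite 1?eq_sym//.
apply/eqP => /setP/(_ w); rewrite !inE eqxx !(eq_sym w) (negbTE aw) (negbTE bw).
by rewrite orbT.
Qed.

Variant shape_class (G : hypergraph) : Prop :=
| ShapeClass (v w z a b : G) (uni : unistruct v (shape_parent v w z) a b) of
    uniq [:: v; a; b; w] & [|| z == v, z == a | z \notin [:: v; a; b; w]] &
    hiso (power_hypergraph m G) (power_hypergraph m (ugraph uni)).

(** [uni3] is meant to be the model of U_3C(k-4) and acts as the threshold: a graph either falls
    below it or is one of the three shapes. *)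
Lemma classify (G : hypergraph) (V3 : finType) (v3 w3 z3 a3 b3 : V3)
    (uni3 : unistruct v3 (shape_parent v3 w3 z3) a3 b3) :
  #|V3| = k -> uniq [:: v3; a3; b3; w3; z3] ->
  huniform 2 G -> hconnected G -> #|hedges G| = k ->
  (exists! C : {set {set power_hypergraph m G}},
    C \subset hedges (power_hypergraph m G) /\ is_loose_cycle C) ->
  shape_class G \/ (lambda1 R m (power_hypergraph m G) < lam uni3)%R.
Proof.
move=> cV3 us3 G_unif G_conn cG G_cyc; have k7 := k_gt7 mk.
have : uniq [:: v3; a3; b3; w3] by move: us3; rewrite -[[:: v3; a3; b3; w3; z3]]/([:: v3; a3; b3; w3] ++ [:: z3]) cat_uniq => /and3P[].
rewrite /= !inE !negb_or => /and4P[/and3P[va3 vb3 vw3] /andP[ab3 aw3] bw3 _].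
set tau := (((m - 1)%:R : R) * lambda1 R m (power_hypergraph m G))%R.
have wv3 : w3 != v3 by rewrite eq_sym.
have m0 : (0 < (m - 1)%:R :> R)%R by rewrite ltr0n subn_gt0.
have [above|lt_tau] := above_or_below m_gt1 mk cV3 uni3 tau wv3 aw3 bw3; last first.
  by right; rewrite -(ltr_pM2l m0).
have [sg0 _] := above.
have [e eG] : exists e, e \in hedges G.
  by apply/card_gt0P; rewrite cG (leq_trans _ k7).
have [u0 _] : exists u, u \in e.
  by apply/card_gt0P; rewrite (G_unif _ eG).
have G0 : 0 < #|G| by apply/card_gt0P; exists u0.
have [x [x_ge0 x_neq0 xE]] := power_perron m_gt1 G_unif G0 sg0.
have x_gt0 := graph_eigen_pos G_conn x_ge0 x_neq0 xE.
pose v := [arg max_(u > u0) x u]%O.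
have v_max u : (x u <= x v)%R by rewrite /v; case: arg_maxP => // i _; apply.
have [p [a [b [uni GE]]]] := unicyclic_structure G_unif v G_conn G_cyc.
have [ab av bv pu inj] := uni.
have cV : #|G| = k by rewrite -cG GE card_imset.
have [rng card_le] := above_starP m_gt1 mk above.
have far_unique y1 y2 : y1 != v -> p y1 != v -> y2 != v -> p y2 != v -> y1 = y2.
  move=> y1v py1 y2v py2; apply/eqP/contraT => y12; exfalso.
  (* Normalised at the maximal vertex, since the budget argument needs values in [0, 1] and 1 at the
     root. *)
  pose y u := (x u / x v)%R.
  have yE : graph_eigen ((m%:R - 2) / (tau + 1)) (tau - m%:R + 2) y.
    move=> u; rewrite /y mulrA xE mulr_suml; apply: eq_bigr => A _.
    by rewrite mulrBl mulr_suml mulrA.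
  apply: (@two_far_absurd R G v p a b _ _ y uni rng _ _ _ _ y1 y2) => //.
  - by rewrite cV.
  - move=> u; rewrite /y; apply/andP; split; first by rewrite divr_ge0// ltW.
    by rewrite ler_pdivrMr// mul1r v_max.
  - by rewrite /y divff// gt_eqF.
  - by rewrite -GE; exact: graph_eigen_qform.
have modelE (z w a' b' : G) (uni' : unistruct v (shape_parent v w z) a' b') :
    hedges G = [set uedge v (shape_parent v w z) a' b' u | u : G] ->
    hiso (power_hypergraph m G) (power_hypergraph m (ugraph uni')).
  by move=> GE'; apply: hiso_power => //; exact: hiso_id_edges.
have [far|no_far] := boolP [exists w, (w != v) && (p w != v)]; last first.
  have pv u : u != v -> p u = v.
    move=> uv; apply/eqP; move: no_far; rewrite negb_exists => /forallP/(_ u).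
    by rewrite uv negbK.
  have [w w_out] : exists w, w \notin [:: v; a; b].
    by apply: exists_notin; rewrite /= cV (leq_trans _ k7).
  have pE u : u != v -> p u = shape_parent v w v u by rewrite /shape_parent => /pv ->; case: ifP.
  have [uni' E] := unistruct_ext pE uni.
  left; exists v w v a b uni'; rewrite ?eqxx//.
    rewrite -[[:: v; a; b; w]]/([:: v; a; b] ++ [:: w]) cats1 rcons_uniq w_out /=.
    by rewrite !inE negb_or !(eq_sym v) av bv ab.
  by apply: modelE; rewrite GE; apply: eq_imset.
have {far} [w /andP[wv pwv]] := existsP far.
set z := p w in pwv.
have pE u : u != v -> p u = shape_parent v w z u.
  move=> uv; rewrite /shape_parent; have [->//|uw] := eqVneq u w.
  by apply/eqP/contraT => puv; rewrite (far_unique u w) ?eqxx in uw.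
have [uni1 E1] := unistruct_ext pE uni.
have [uni2 E2] := unistruct_swap uni1.
have GE1 : hedges G = [set uedge v (shape_parent v w z) a b u | u : G].
  by rewrite GE; apply: eq_imset.
have GE2 : hedges G = [set uedge v (shape_parent v w z) b a u | u : G].
  by rewrite GE1; apply: eq_imset.
have zw : z != w by exact: pu.
(* When w is an end of the extra edge, the cycle is the quadrangle v z w c, and a further vertex y
   gives a copy of U_3C(k-4) on the same vertices that beats it. *)
have C4 (c : G) (uniC : unistruct v (shape_parent v w z) c w) :
    hedges G = [set uedge v (shape_parent v w z) c w u | u : G] ->
    (lambda1 R m (power_hypergraph m G) < lam uni3)%R.
  move=> GEC; have [cw cv _ _ _] := uniC.
  have zc : z != c.
    have := parent_ab uniC wv; rewrite set22 /shape_parent eqxx => /(_ isT).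
    by rewrite !inE negb_or => /andP[].
  have [y] : exists y, y \notin [:: v; w; c; z].
    by apply: exists_notin; rewrite /= cV (leq_trans _ k7).
  rewrite !inE !negb_or => /and4P[yv yw yc yz].
  have uy : unistruct v (shape_parent v w y) c z.
    apply: shape_pair; rewrite /= !inE !negb_or ?(eq_sym v) ?cv ?pwv ?wv ?(eq_sym c) ?zc ?zw ?yv ?yc ?yz ?yw ?orbT//.
    by rewrite eq_sym cw.
  have isoC := modelE _ _ _ _ uniC GEC.
  have eC := lambda1_hiso R m_gt1 (power_gt0 v) isoC.
  have aboveC : above_star m k (((m - 1)%:R : R) * lam uniC)%R by rewrite -eC.
  have lt_C : (lam uniC < lam uy)%R by apply: (lambda_lt3C m_gt1 mk) aboveC.
rewrite eC; apply: (lt_le_trans lt_C).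
  have [h h_bij [hv hc hz hw hy]] : exists2 h : G -> V3, bijective h &
      map h [:: v; c; z; w; y] = [:: v3; a3; b3; w3; z3].
    apply: bijection_extend => //; first by rewrite cV cV3.
    rewrite /= !inE !negb_or !(eq_sym v) cv pwv wv yv !(eq_sym c) zc yc zw.
    by rewrite (eq_sym z) yz (eq_sym w y) yw eq_sym cw.
  by rewrite (lambda1_hiso R m_gt1 (power_gt0 (G := ugraph uy) v) (shape_transfer uy uni3 h_bij hv hw hy hc hz)).
have [wa|wa] := eqVneq w a.
  right; rewrite -wa in uni2 GE2; exact: C4 GE2.
have [wb|wb] := eqVneq w b.
  right; rewrite -wb in uni1 GE1; exact: C4 GE1.
(* For z = b, exchanging a and b brings the graph to the shape with z = a. *)
left; have [zb|zb] := eqVneq z b.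
  exists v w z b a uni2; [|by rewrite zb eqxx orbT|exact: modelE].
  by rewrite /= !inE !negb_or !(eq_sym v) av bv wv (eq_sym b) ab !(eq_sym _ w) wa wb.
exists v w z a b uni1; [| |exact: modelE].
  by rewrite /= !inE !negb_or !(eq_sym v) av bv wv ab !(eq_sym _ w) wa wb.
by rewrite !inE !negb_or (negbTE pwv) zb zw /= !andbT orbN.
Qed.

End ShapeModels.

Theorem theorem3p4p1 (R : realType) (m k : nat) :
  2 <= m -> 20 <= (k - 7) * (m - 1) ->
  [/\ unicyclic_power m k (UC m 3 [:: k - 3]),
      unicyclic_power m k (UC m 3 [:: k - 4; 1])
    & unicyclic_power m k (U3C m (k - 4))] /\
  [/\ (lambda1 R m (UC m 3 [:: k - 3])%N
         > lambda1 R m (UC m 3 [:: k - 4; 1])%N)%R,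
      (lambda1 R m (UC m 3 [:: k - 4; 1])%N > lambda1 R m (U3C m (k - 4))%N)%R
    & forall H : hypergraph,
        unicyclic_power m k H ->
        ~ hiso H (UC m 3 [:: k - 3]) ->
        ~ hiso H (UC m 3 [:: k - 4; 1]) ->
        ~ hiso H (U3C m (k - 4)) ->
        (lambda1 R m H < lambda1 R m (U3C m (k - 4))%N)%R].
Proof.
move=> m_gt1 mk; have k7 := k_gt7 mk.
have [V1 [v1 [w1 [a1 [b1 M1]]]]] := UC1_model m_gt1 k7.
have [V2 [v2 [w2 [a2 [b2 M2]]]]] := UC2_model m_gt1 k7.
have [V3 [v3 [w3 [z3 [a3 [b3 [M3 us3]]]]]]] := U3C_model m_gt1 k7.
split; first by split; [exact: shape_unicyclic_power M1|exact: shape_unicyclic_power M2|exact: shape_unicyclic_power M3].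
have [cV1 us1 [uni1 iso1]] := M1; have [cV2 us2 [uni2 iso2]] := M2.
have [cV3 us3' [uni3 iso3]] := M3.
rewrite (shape_lambda R m_gt1 iso1) (shape_lambda R m_gt1 iso2) (shape_lambda R m_gt1 iso3).
split.
(* [transplant_lt] needs a common vertex set, so the larger graph is rebuilt on the vertices of the
   smaller one and identified with its own model by a bijection. *)
- have uni2' : unistruct v2 (shape_parent v2 w2 v2) a2 b2 by apply: shape_pair; rewrite ?eqxx.
  have [h h_bij [hv ha hb hw]] : exists2 h : V2 -> V1, bijective h &
    map h [:: v2; a2; b2; w2] = [:: v1; a1; b1; w1] by apply: bijection_extend; rewrite ?cV2.
  rewrite -(lambda1_hiso R m_gt1 (power_gt0 m (G := ugraph uni2') v2) (shape_transfer m_gt1 uni2' uni1 h_bij hv hw hv ha hb)).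
  have [vw aw bw] : [/\ v2 != w2, a2 != w2 & b2 != w2].
    by move: us2; rewrite /= !inE !negb_or => /and4P[/and3P[_ _ ->] /andP[_ ->] ->].
  by apply: (lambda_lt12 R m_gt1 mk cV2); rewrite // eq_sym.
- have uni3' : unistruct v3 (shape_parent v3 w3 a3) a3 b3 by apply: shape_pair; rewrite ?eqxx ?orbT.
  have [h h_bij [hv ha hb hw]] : exists2 h : V3 -> V2, bijective h &
    map h [:: v3; a3; b3; w3] = [:: v2; a2; b2; w2] by apply: bijection_extend; rewrite ?cV3.
  rewrite -(lambda1_hiso R m_gt1 (power_gt0 m (G := ugraph uni3') v3) (shape_transfer m_gt1 uni3' uni2 h_bij hv hw ha ha hb)).
  have [[vw aw bw] [vz az bz]] : [/\ v3 != w3, a3 != w3 & b3 != w3] /\ [/\ v3 != z3, a3 != z3 & b3 != z3].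
    by move: us3; rewrite /= !inE !negb_or => /and5P[/and4P[_ _ -> ->] /and3P[_ -> ->] /andP[-> ->]].
  by apply: (lambda_lt23 R m_gt1 mk cV3); rewrite // eq_sym.
move=> H [H_conn H_uni _ cH [G G_unif iso]] n1 n2 n3.
have P_conn := hiso_connected (hiso_sym iso) H_conn.
have [_ P_cyc] := hiso_unicyclic (hiso_sym iso) H_uni.
have cG : #|hedges G| = k.
  by rewrite -cH (hiso_card_hedges iso) hedges_power card_imset//; exact: pedge_inj.
have [u _] : exists u, u \in [set: G].
  apply/set0Pn; have [e eG] : exists e, e \in hedges G.
    by apply/card_gt0P; rewrite cG (leq_trans _ k7).
  have : 0 < #|e| by rewrite (G_unif _ eG).
  by case/card_gt0P => u _; apply/set0Pn; exists u.
rewrite -(lambda1_hiso R m_gt1 (power_gt0 m u) iso).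
have [] := classify R m_gt1 mk uni3 cV3 us3 G_unif (power_connected_graph P_conn) cG P_cyc => //.
case=> v w z a b uni us zP isoG; exfalso.
have isoH := hiso_trans (hiso_sym iso) isoG.
have cV : #|G| = k.
  by rewrite -(ugraph_edges_card m uni) -(hiso_card_hedges (hiso_sym isoG)) hedges_power card_imset; [|exact: pedge_inj].
case/or3P: zP => [/eqP zv|/eqP za|z_out].
- have [h h_bij [hv ha hb hw]] : exists2 h : G -> V1, bijective h &
    map h [:: v; a; b; w] = [:: v1; a1; b1; w1] by apply: bijection_extend; rewrite ?cV.
  apply: n1; apply: hiso_trans isoH (hiso_trans _ iso1).
  by apply: (shape_transfer m_gt1 uni uni1 h_bij); rewrite ?zv.
- have [h h_bij [hv ha hb hw]] : exists2 h : G -> V2, bijective h &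
    map h [:: v; a; b; w] = [:: v2; a2; b2; w2] by apply: bijection_extend; rewrite ?cV.
  apply: n2; apply: hiso_trans isoH (hiso_trans _ iso2).
  by apply: (shape_transfer m_gt1 uni uni2 h_bij); rewrite ?za.
have [h h_bij [hv ha hb hw hz]] : exists2 h : G -> V3, bijective h &
  map h [:: v; a; b; w; z] = [:: v3; a3; b3; w3; z3].
  apply: bijection_extend; rewrite ?cV//.
  by rewrite -[[:: v; a; b; w; z]]/([:: v; a; b; w] ++ [:: z]) cats1 rcons_uniq z_out.
apply: n3; apply: hiso_trans isoH (hiso_trans _ iso3).
exact: (shape_transfer m_gt1 uni uni3 h_bij).
Qed.
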